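(* Let $L$ be a two-sided non-zero L\'evy process with expectation zero and finite fourth moment, and let $d\in(0,1/2)$. For $i=1,2$ let $X^i_t=M^i_{t;d}-M^i_{t-1;d}$, $t\in\mathbb{Z}$, be the corresponding fractional L\'evy noises. Then the sequences $X^1=(X^1_t)_{t\in\mathbb{Z}}$ and $X^2=(X^2_t)_{t\in\mathbb{Z}}$ are not strongly mixing.
   Context: A two-sided L\'evy process $L=(L_t)_{t\in\mathbb{R}}$ is a stochastic process with independent and stationary increments, c\`adl\`ag sample paths and $L_0=0$. With $(x)_+=\max(x,0)$ and $(x)_+^d=((x)_+)^d$, the two fractional L\'evy processes are $$M^1_{t;d}=\frac1{\Gamma(d+1)}\int_{-\infty}^\infty\left[(t-s)_+^d-(-s)_+^d\right]dL_s,\qquad M^2_{t;d}=\int_{-\infty}^\infty\left[|t-s|^d-|s|^d\right]dL_s,\qquad t\in\mathbb{R},$$ where the integrals are defined in the $L^2(P)$ sense. A stationary sequence $(X_n)_{n\in\mathbb{Z}}$ is strongly mixing if $\lim_{n\to\infty}\alpha_X(n)=0$, where $$\alpha_X(n)=\sup\{|P(A\cap B)-P(A)P(B)|:\ A\in\sigma(X_k,\,k\le0),\ B\in\sigma(X_k,\,k\ge n)\}.$$ *)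

(* Defs.v *)
From HB Require Import structures.
From mathcomp Require Import all_boot all_order all_algebra.
From mathcomp Require Import all_classical all_reals all_analysis.

Set Implicit Arguments.
Unset Strict Implicit.
Unset Printing Implicit Defensive.

Import Order.TTheory GRing.Theory Num.Theory.
Import numFieldNormedType.Exports.

Local Open Scope classical_set_scope.
Local Open Scope ring_scope.

Section Processes.
Context (R : realType) (disp : measure_display) (T : measurableType disp).
Variable P : probability T R.

(* The factors [B i = setT] are allowed, so this covers all subfamilies. *)
Definition mutually_independent (n : nat) (X : 'I_n -> T -> R) : Prop :=
  forall B : 'I_n -> set R, (forall i, measurable (B i)) ->
    P (\bigcap_i (X i @^-1` B i)) = (\prod_(i < n) P (X i @^-1` B i))%E.

Definition independent_increments (L : R -> {RV P >-> R}) : Prop :=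
  forall (n : nat) (t : nat -> R),
    (forall i, (i < n)%N -> t i < t i.+1) ->
    mutually_independent (fun (i : 'I_n) w => L (t i.+1) w - L (t i) w).

(* Laws are compared on Borel sets only: the values of a measure on
   non-measurable sets are unspecified. *)
Definition stationary_increments (L : R -> {RV P >-> R}) : Prop :=
  forall (s t h : R) (B : set R), s <= t -> measurable B ->
    P ((fun w => L (t + h) w - L (s + h) w) @^-1` B) =
    P ((fun w => L t w - L s w) @^-1` B).

Definition cadlag (f : R -> R) : Prop :=
  forall t : R, (f x @[x --> t^'+] --> f t) /\ cvg (f x @[x --> t^'-]).

Definition two_sided_levy (L : R -> {RV P >-> R}) : Prop :=
  [/\ independent_increments L,
      stationary_increments L,
      forall w, cadlag (fun t => L t w)
    & forall w, L 0 w = 0].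

(* A list of triples [(a, (s, t))] codes the step function
   \sum a 1_{]s, t]}; the bounds have to satisfy s <= t, since otherwise the
   indicator vanishes while the increment [L t - L s] does not. *)
Definition step_code_ok (c : seq (R * (R * R))) : bool :=
  all (fun p => p.2.1 <= p.2.2) c.

Definition step_fun (c : seq (R * (R * R))) (x : R) : R :=
  \sum_(p <- c) p.1 * \1_(`]p.2.1, p.2.2]%classic : set R) x.

Definition step_integral (L : R -> {RV P >-> R}) (c : seq (R * (R * R)))
    (w : T) : R :=
  \sum_(p <- c) p.1 * (L p.2.2 w - L p.2.1 w).

(* [I] is a version of the L^2(P)-integral \int f dL: it is the L^2(P)-limit
   of the integrals of step functions converging to [f] in L^2(R).  For a
   centred square-integrable L the isometry
   E[(\int f dL)^2] = E[L_1^2] \int f^2 makes such an [I] exist for every f in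
   L^2(R), unique up to null sets and independent of the approximation. *)
Definition is_L2_integral (L : R -> {RV P >-> R}) (f : R -> R)
    (I : {RV P >-> R}) : Prop :=
  exists c : nat -> seq (R * (R * R)),
    [/\ forall n, step_code_ok (c n),
        'N[lebesgue_measure]_2%:E[(fun x : R => (step_fun (c n) x - f x)%:E)]%E
          @[n --> \oo] --> 0%E
      & 'N[P]_2%:E[(fun w => (step_integral L (c n) w - I w)%:E)]%E
          @[n --> \oo] --> 0%E].

Definition Gamma (a : R) : R :=
  \int[lebesgue_measure]_(x in `]0, +oo[) (x `^ (a - 1) * expR (- x)).

Definition pos_pow (x d : R) : R := (Num.max x 0) `^ d.

Definition kernel1 (d t s : R) : R := pos_pow (t - s) d - pos_pow (- s) d.

Definition kernel2 (d t s : R) : R := `|t - s| `^ d - `|s| `^ d.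

Definition fractional_levy1 (L : R -> {RV P >-> R}) (d : R)
    (M : R -> {RV P >-> R}) : Prop :=
  forall t, exists2 I : {RV P >-> R}, is_L2_integral L (kernel1 d t) I &
    forall w, M t w = (Gamma (d + 1))^-1 * I w.

Definition fractional_levy2 (L : R -> {RV P >-> R}) (d : R)
    (M : R -> {RV P >-> R}) : Prop :=
  forall t, is_L2_integral L (kernel2 d t) (M t).

Definition noise (M : R -> {RV P >-> R}) (t : int) (w : T) : R :=
  M t%:~R w - M (t%:~R - 1) w.

Definition sigma_of (X : int -> T -> R) (K : set int) : set (set T) :=
  <<s \bigcup_(k in K) preimage_set_system setT (X k) measurable >>.

Definition alpha_mixing (X : int -> T -> R) (n : nat) : \bar R :=
  ereal_sup [set `|P (A `&` B) - P A * P B|%E |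
    A in sigma_of X [set k | k <= 0] & B in sigma_of X [set k | n%:Z <= k]].

(* Stationarity of [X] is not included: it is a property of the sequences this
   is applied to, and including it would weaken the negation. *)
Definition strongly_mixing (X : int -> T -> R) : Prop :=
  alpha_mixing X n @[n --> \oo] --> 0%E.

End Processes.

(* Main.v *)
Require Import Defs.
From HB Require Import structures.
From mathcomp Require Import all_boot all_order all_algebra.
From mathcomp Require Import all_classical all_reals all_analysis.
From mathcomp Require Import measurable_realfun ring lra.

Set Implicit Arguments.
Unset Strict Implicit.
Unset Printing Implicit Defensive.

Import Order.TTheory GRing.Theory Num.Theory.
Import numFieldNormedType.Exports.

Local Open Scope classical_set_scope.
Local Open Scope ring_scope.

(** Let M be one of the two fractional processes.  The increments
    U = M_0 - M_(-n) and V = M_(2n) - M_n are sums of noise variables X_k with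
    k <= 0 and with k > n, so U and V are measurable with respect to the two
    sigma-algebras compared by alpha(n).  The proof shows that the correlation
    of U and V does not depend on n and is positive, whereas strong mixing
    would force it to tend to 0.

    The correlation.  Both kernels have the form psi(t - u) - psi(- u) with
    psi(x) = (x)_+^d or |x|^d, and psi(h x) = h^d psi(x) for h > 0.  The
    isometry of the L^2 integral ([L2approx_isometry]) and an affine change of
    variable ([kernel_scale]) give E(M_t - M_s)^2 = c (t - s)^(2d+1) with
    c > 0.  Polarization over the points -n, 0, n, 2n turns this into
    E(U V) = c n^(2d+1) (3^(2d+1) + 1 - 2 * 2^(2d+1)) / 2, and the last factor
    is positive because x^(2d+1) is strictly convex ([strict_convexity]).

    The effect of mixing.  If the quantizer h takes finitely many values, then
    the covariance of h(U) and h(V) is a finite combination of the differences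
    P(A, B) - P(A) P(B) with A in the past and B in the future, so it is at most
    a constant times alpha(n) ([quantize_cov]).  It remains to replace U and V,
    divided by n^(d+1/2), by their quantized versions with an L^2 error that is
    uniform in n ([mixing_covariance]).  This is uniform integrability of the
    squares, and it comes from fourth moments: for independent centred xi_i,
    the fourth moment of sum v_i xi_i is at most
    sum v_i^4 E xi_i^4 + 3 (sum v_i^2 E xi_i^2)^2, and E L_t^4 is at most
    K (t + t^2), so the integral of a step function with values in [-B, B] and
    squared norm F has fourth moment at most K (B^2 F + F^2) ([m4_grid]).  The
    kernels of U and V are bounded by n^d with squared norm of order n^(2d+1),
    which makes this bound of order n^(4d+2).

    An L^2 integral is known only through approximating step functions that
    need not be bounded.  Truncating them does not spoil the approximation of a
    bounded kernel, and by the isometry it does not change the limit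
    ([L2approx_bounded]); so U and V are L^2-close to variables with a
    controlled fourth moment, which is all that the quantization uses. *)

(** * Square-integrable functions *)

Section SquareIntegrable.
Context (R : realType) (disp : measure_display) (T : measurableType disp).
Variable mu : {measure set T -> \bar R}.
Implicit Types f g h : T -> R.

Definition sqint f :=
  measurable_fun setT f /\ mu.-integrable setT (EFin \o (fun x => f x ^+ 2)).

Definition nsq f : R := \int[mu]_x (f x ^+ 2).

Lemma integrable_le f g : measurable_fun setT f ->
  (forall x, `|f x| <= g x) -> mu.-integrable setT (EFin \o g) ->
  mu.-integrable setT (EFin \o f).
Proof.
move=> mf fg; apply: le_integrable => //; first exact/measurable_EFinP.
by move=> x _ /=; rewrite lee_fin (le_trans (fg x))// ler_norm.
Qed.

Lemma integrableD_fun f g : mu.-integrable setT (EFin \o f) ->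
  mu.-integrable setT (EFin \o g) ->
  mu.-integrable setT (EFin \o (fun x => f x + g x)).
Proof. by move=> fi gi; have := integrableD measurableT fi gi. Qed.

Lemma integrableZ_fun (a : R) f : mu.-integrable setT (EFin \o f) ->
  mu.-integrable setT (EFin \o (fun x => a * f x)).
Proof. by move=> fi; have := integrableZl measurableT a fi. Qed.

Lemma integrable_sum_fun I (s : seq I) (F : I -> T -> R) :
  (forall i, mu.-integrable setT (EFin \o F i)) ->
  mu.-integrable setT (EFin \o (fun x => \sum_(i <- s) F i x)).
Proof.
move=> Fi; have := @integrable_sum _ _ _ mu setT measurableT I s xpredT
  (fun i x => (F i x)%:E) (fun i _ => Fi i).
by congr (integrable _ _ _); apply/funext => x /=; rewrite sumEFin.
Qed.

Lemma Rintegral_sum I (s : seq I) (F : I -> T -> R) :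
  (forall i, mu.-integrable setT (EFin \o F i)) ->
  \int[mu]_x (\sum_(i <- s) F i x) = \sum_(i <- s) \int[mu]_x F i x.
Proof.
move=> Fi; elim: s => [|i s IH].
  under eq_Rintegral do rewrite big_nil.
  by rewrite big_nil Rintegral_cst ?measurableT// mul0r.
under eq_Rintegral do rewrite big_cons.
by rewrite big_cons RintegralD ?IH//; exact: integrable_sum_fun.
Qed.

Lemma sqint_integrable f : sqint f ->
  mu.-integrable setT (EFin \o (fun x => f x ^+ 2)).
Proof. by case. Qed.

Lemma sqint_measurable f : sqint f -> measurable_fun setT f.
Proof. by case. Qed.

Lemma sqint_le f g : measurable_fun setT f -> (forall x, `|f x| <= `|g x|) ->
  sqint g -> sqint f.
Proof.
move=> mf fg [mg gi]; split => //.
apply: (@integrable_le _ (fun x => g x ^+ 2)) => //; first exact: measurable_funX.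
by move=> x; rewrite normrX -[leRHS]real_normK ?num_real// lerXn2r ?nnegrE.
Qed.

Lemma sqint_mul f g : sqint f -> sqint g ->
  mu.-integrable setT (EFin \o (fun x => f x * g x)).
Proof.
move=> [mf fi] [mg gi].
apply: (@integrable_le _ (fun x => f x ^+ 2 + g x ^+ 2)).
- exact: measurable_funM.
- move=> x; have := sqr_ge0 (f x + g x); have := sqr_ge0 (f x - g x).
  have := sqr_ge0 (f x); have := sqr_ge0 (g x).
  rewrite ler_norml sqrrB sqrrD => *; apply/andP; split; lra.
- exact: integrableD_fun.
Qed.

Lemma sqintD f g : sqint f -> sqint g -> sqint (fun x => f x + g x).
Proof.
move=> sf sg; have [mf fi] := sf; have [mg gi] := sg; split.
  exact: measurable_funD.
apply: (@integrable_le _ (fun x => 2 * f x ^+ 2 + 2 * g x ^+ 2)).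
- by apply: measurable_funX; exact: measurable_funD.
- move=> x; rewrite ger0_norm ?sqr_ge0//; have := sqr_ge0 (f x - g x).
  by rewrite sqrrB sqrrD; lra.
- by apply: integrableD_fun; exact: integrableZ_fun.
Qed.

Lemma sqintZ (a : R) f : sqint f -> sqint (fun x => a * f x).
Proof.
move=> [mf fi]; split; first exact: measurable_funM.
have := integrableZ_fun (a ^+ 2) fi; congr (integrable _ _ _).
by apply/funext => x /=; rewrite exprMn.
Qed.

Lemma sqintB f g : sqint f -> sqint g -> sqint (fun x => f x - g x).
Proof.
move=> sf sg; have := sqintD sf (sqintZ (-1) sg); congr (sqint _).
by apply/funext => x; rewrite mulN1r.
Qed.

Lemma nsq_ge0 f : 0 <= nsq f.
Proof. by apply: Rintegral_ge0 => x _; exact: sqr_ge0. Qed.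

Lemma nsqZ (a : R) f : sqint f -> nsq (fun x => a * f x) = a ^+ 2 * nsq f.
Proof.
move=> [mf fi]; rewrite /nsq -RintegralZl//.
by apply: eq_Rintegral => x _; rewrite exprMn.
Qed.

Lemma nsq_le f g : sqint f -> sqint g -> (forall x, `|f x| <= `|g x|) ->
  nsq f <= nsq g.
Proof.
move=> [_ fi] [_ gi] fg; apply: le_Rintegral => // x _.
by rewrite -[leLHS]real_normK ?num_real// -[leRHS]real_normK ?num_real// lerXn2r ?nnegrE.
Qed.

Lemma nsqD f g : sqint f -> sqint g ->
  nsq (fun x => f x + g x) = nsq f + 2 * \int[mu]_x (f x * g x) + nsq g.
Proof.
move=> sf sg; have fgi := sqint_mul sf sg.
rewrite /nsq -RintegralZl// -RintegralD//; last 2 first.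
- exact: sqint_integrable.
- exact: integrableZ_fun.
rewrite -RintegralD//; last 2 first.
- by apply: integrableD_fun; [exact: sqint_integrable|exact: integrableZ_fun].
- exact: sqint_integrable.
by apply: eq_Rintegral => x _; ring.
Qed.

(** Used in place of the Cauchy-Schwarz inequality: for a fixed t the bound is
    linear in the squared norms, so no square roots occur. *)
Lemma young_int f g (t : R) : 0 < t -> sqint f -> sqint g ->
  `|\int[mu]_x (f x * g x)| <= nsq f / (2 * t) + t / 2 * nsq g.
Proof.
move=> t0 sf sg; have fgi := sqint_mul sf sg.
have ti : 0 < t^-1 by rewrite invr_gt0.
have tt : t * t^-1 = 1 by rewrite divff// gt_eqF.
have -> : nsq f / (2 * t) + t / 2 * nsq g =
    \int[mu]_x ((2 * t)^-1 * f x ^+ 2 + t / 2 * g x ^+ 2).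
  rewrite RintegralD//; last 2 first.
  - by apply: integrableZ_fun; exact: sqint_integrable.
  - by apply: integrableZ_fun; exact: sqint_integrable.
  rewrite RintegralZl//; last exact: sqint_integrable.
  by rewrite RintegralZl ?[_ / (2 * t)]mulrC//; exact: sqint_integrable.
apply: le_trans (le_normr_Rintegral _ fgi) _ => //.
apply: le_Rintegral => //.
- exact: (@integrable_norm _ _ _ mu setT _ fgi).
- by apply: integrableD_fun; apply: integrableZ_fun; exact: sqint_integrable.
move=> x _ /=; rewrite normrM invfM.
rewrite -[f x ^+ 2]real_normK ?num_real// -[g x ^+ 2]real_normK ?num_real//.
set a := `|f x|; set b := `|g x|.
have : 0 <= t^-1 * (a - t * b) ^+ 2 by rewrite mulr_ge0 ?sqr_ge0 ?ltW.
have -> : t^-1 * (a - t * b) ^+ 2 =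
  t^-1 * a ^+ 2 - 2 * (t * t^-1) * a * b + t * (t * t^-1) * b ^+ 2 by ring.
rewrite tt; lra.
Qed.

Lemma nsq_eq f g : f =1 g -> nsq f = nsq g.
Proof. by move=> fg; congr nsq; apply/funext. Qed.

Lemma nsqD_le f g : sqint f -> sqint g ->
  nsq (fun x => f x + g x) <= 2 * nsq f + 2 * nsq g.
Proof.
move=> sf sg; rewrite nsqD//.
have := young_int (ltr01) sf sg; rewrite ler_norml => /andP[_]; lra.
Qed.

Lemma nsqB_le f g h : sqint f -> sqint g -> sqint h ->
  nsq (fun x => f x - h x) <=
  2 * nsq (fun x => f x - g x) + 2 * nsq (fun x => g x - h x).
Proof.
move=> sf sg sh.
rewrite (@nsq_eq _ (fun x => (f x - g x) + (g x - h x))); last by move=> x; ring.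
by apply: nsqD_le; exact: sqintB.
Qed.

Lemma nsqBC f g : nsq (fun x => f x - g x) = nsq (fun x => g x - f x).
Proof. by apply: eq_Rintegral => x _; ring. Qed.

(** Expanding the square of (g - f) + f leaves a cross term, which Young's
    inequality with a small t controls. *)
Lemma nsq_cont f (e : R) : sqint f -> 0 < e -> exists2 dl : R, 0 < dl &
  forall g, sqint g -> nsq (fun x => g x - f x) <= dl -> `|nsq g - nsq f| <= e.
Proof.
move=> sf e0; pose F := nsq f; have F0 : 0 <= F := nsq_ge0 f.
pose t := e / (2 * (F + 1)).
have t0 : 0 < t by rewrite divr_gt0// mulr_gt0//; lra.
have ti : 0 < t^-1 by rewrite invr_gt0.
pose dl := e / (2 * (1 + t^-1)).
have d0 : 0 < dl by rewrite divr_gt0// mulr_gt0//; lra.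
exists dl => // g sg gf; have sgf := sqintB sg sf.
rewrite (@nsq_eq g (fun x => (g x - f x) + f x)); last by move=> x; ring.
rewrite nsqD//.
have := young_int t0 sgf sf; rewrite -/F.
set N := nsq _ in gf *; set Y := Rintegral _ _ _ => YY.
have N0 : 0 <= N by exact: nsq_ge0.
have tF : t * (F + 1) = e / 2 by rewrite /t; field; rewrite gt_eqF//; lra.
have dt : dl * (1 + t^-1) = e / 2 by rewrite /dl; field; rewrite !gt_eqF//; lra.
have -> : N + 2 * Y + F - F = N + 2 * Y by ring.
apply: le_trans (ler_normD _ _) _; rewrite ger0_norm// normrM (ger0_norm (_ : 0 <= 2))//.
rewrite invfM in YY.
have h1 : N * (1 + t^-1) <= e / 2 by rewrite -dt ler_wpM2r//; lra.
nra.
Qed.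

Lemma nsqB_le2 f g : sqint f -> sqint g ->
  nsq (fun x => f x - g x) <= 2 * nsq f + 2 * nsq g.
Proof.
move=> sf sg; have := nsqD_le sf (sqintZ (-1) sg).
rewrite nsqZ// sqrrN expr1n mul1r; congr (_ <= _).
by apply: nsq_eq => x; rewrite mulN1r.
Qed.

End SquareIntegrable.

Section SquareIntegrableFinite.
Context (R : realType) (disp : measure_display) (T : measurableType disp).
Variable P : probability T R.
Implicit Types f g h : T -> R.

Lemma integrable_bounded f (M : R) : measurable_fun setT f ->
  (forall x, `|f x| <= M) -> P.-integrable setT (EFin \o f).
Proof.
move=> mf fM; apply: (@integrable_le _ _ _ _ _ (cst M)) => //.
exact: finite_measure_integrable_cst.
Qed.

Lemma sqint_cst (a : R) : sqint P (fun=> a).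
Proof.
split; first exact: measurable_cst.
by apply: (@integrable_bounded _ (a ^+ 2)) => // x; rewrite ger0_norm ?sqr_ge0.
Qed.

Lemma sqint_integrable1 f : sqint P f -> P.-integrable setT (EFin \o f).
Proof.
move=> sf; have := sqint_mul sf (sqint_cst 1); congr (integrable _ _ _).
by apply/funext => x /=; rewrite mulr1.
Qed.

Lemma Rintegral_cstP (a : R) : \int[P]_x a = a.
Proof. by rewrite /Rintegral integral_cst//= probability_setT mule1. Qed.

(** The variance is nonnegative. *)
Lemma sqr_mean_le f : sqint P f -> (\int[P]_x f x) ^+ 2 <= nsq P f.
Proof.
move=> sf; set m := Rintegral _ _ _.
have := nsq_ge0 P (fun x => f x + (- m)).
rewrite nsqD//; last exact: sqint_cst.
rewrite [\int[P]_x (f x * - m)](_ : _ = - m ^+ 2); last first.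
  by rewrite RintegralZr//; [rewrite -/m; ring|exact: sqint_integrable1].
rewrite /nsq Rintegral_cstP; lra.
Qed.

End SquareIntegrableFinite.

(** * Independence *)

Section Independence.
Context (R : realType) (disp : measure_display) (T : measurableType disp).
Variable P : probability T R.

Definition indep (X Y : T -> R) := forall A B : set R,
  measurable A -> measurable B ->
  P (X @^-1` A `&` Y @^-1` B) = (P (X @^-1` A) * P (Y @^-1` B))%E.

Lemma indep_comp (X Y : T -> R) (f g : R -> R) :
  measurable_fun setT f -> measurable_fun setT g ->
  indep X Y -> indep (f \o X) (g \o Y).
Proof.
move=> mf mg XY A B mA mB; apply: (XY (f @^-1` A) (g @^-1` B)).
- by rewrite -[X in measurable X]setTI; exact: mf.
- by rewrite -[X in measurable X]setTI; exact: mg.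
Qed.

(** The joint law of X and Y is the product of their laws, so the integral of
    the product map splits by Fubini's theorem. *)
Lemma indep_mean_mul (X Y : T -> R) :
  measurable_fun setT X -> measurable_fun setT Y ->
  indep X Y -> P.-integrable setT (EFin \o X) ->
  P.-integrable setT (EFin \o Y) ->
  P.-integrable setT (EFin \o (fun w => X w * Y w)) /\
  \int[P]_w (X w * Y w) = (\int[P]_w X w) * (\int[P]_w Y w).
Proof.
move=> mX mY XY iX iY.
pose Xm : {mfun T >-> R} := HB.pack X (isMeasurableFun.Build _ _ _ _ _ mX).
pose Ym : {mfun T >-> R} := HB.pack Y (isMeasurableFun.Build _ _ _ _ _ mY).
pose XYf w := (X w, Y w).
have mXY : measurable_fun setT XYf by exact: measurable_fun_pair.
pose XYm : {mfun T >-> (R * R)%type} :=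
  HB.pack XYf (isMeasurableFun.Build _ _ _ _ _ mXY).
pose dX := distribution P Xm; pose dY := distribution P Ym.
pose dXY := distribution P XYm.
have dE A : measurable A -> (dX \x dY)%E A = dXY A.
  by move=> mA; apply: product_measure_unique.
have mM : measurable_fun setT (fun z : R * R => (z.1 * z.2)%:E).
  by apply/measurable_EFinP; exact: measurable_funM.
have mN : measurable_fun setT (fun x : R => `|x|%:E).
  by apply/measurable_EFinP; exact: normr_measurable.
have fubT : (\int[dX \x dY]_z `|(z.1 * z.2)%:E| =
    (\int[P]_w `|(X w)%:E|) * (\int[P]_w `|(Y w)%:E|))%E.
  rewrite fubini_tonelli1//=; last first.
    by apply/measurable_EFinP; apply: measurableT_comp => //; exact: measurable_funM.
  rewrite /fubini_F/=.
  under eq_integral => x _.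
    under eq_integral do rewrite normrM EFinM.
    rewrite ge0_integralZl//.
    over.
  rewrite /= ge0_integralZr//; last by apply: integral_ge0 => y _; rewrite lee_fin.
  by rewrite !ge0_integral_distribution.
have iM : (dX \x dY)%E.-integrable setT (fun z : R * R => (z.1 * z.2)%:E).
  apply/integrableP; split => //; rewrite fubT lte_mul_pinfty//.
  - by apply: integral_ge0.
  - by apply: integrable_fin_num => //; exact: integrable_abse.
  - by have /integrableP[] := iY.
have iMP : P.-integrable setT (EFin \o (fun w => X w * Y w)).
  apply/integrableP; split.
    by apply/measurable_EFinP; exact: measurable_funM.
  have /integrableP[_] := iM; congr (_ < _)%E.
  transitivity (\int[dXY]_z `|(z.1 * z.2)%:E|)%E.
    by apply: eq_measure_integral => A mA _; exact: dE.
  rewrite ge0_integral_distribution//=. by apply/measurable_EFinP; apply: measurableT_comp => //; exact: measurable_funM.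
split => //.
rewrite /Rintegral -fineM; [|exact: integrable_fin_num|exact: integrable_fin_num].
congr fine.
transitivity (\int[dXY]_z (z.1 * z.2)%:E)%E.
  by rewrite integral_distribution.
transitivity (\int[dX \x dY]_z (z.1 * z.2)%:E)%E.
  by apply: eq_measure_integral => A mA _; exact: esym (dE A mA).
rewrite -integral12_prod_meas1//.
have iYd : dY.-integrable setT (EFin \o id).
  by apply: integrable_pushforward => //; exact/measurable_EFinP.
have iXd : dX.-integrable setT (EFin \o id).
  by apply: integrable_pushforward => //; exact/measurable_EFinP.
transitivity (\int[dX]_x (x%:E * (\int[P]_w (Y w)%:E)))%E.
  apply: eq_integral => x _; rewrite /fubini_F/=.
  under eq_integral do rewrite EFinM.
  by rewrite integralZl// integral_distribution.
rewrite /= -(fineK (integrable_fin_num measurableT iY)) integralZr//.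
by congr (_ * _)%E; rewrite integral_distribution.
Qed.

Section PartialSums.
Variables (xi : nat -> T -> R) (N : nat).
Hypothesis mxi : forall i, measurable_fun setT (xi i).
Hypothesis xiI : mutually_independent P (fun i : 'I_N => xi i).

(** Dynkin's argument: the events independent of [xi k] form a lambda-system,
    which contains the rectangles in the first k variables and hence the
    sigma-algebra that they generate; the partial sum is measurable for it. *)
Lemma indep_sum (a : nat -> R) (k : nat) : (k < N)%N ->
  indep (fun w => \sum_(i < k) a i * xi i w) (xi k).
Proof.
move=> kN A B mA mB.
have mpre i C : measurable C -> measurable (xi i @^-1` C).
  by move=> mC; rewrite -[X in measurable X]setTI; exact: mxi.
set E := xi k @^-1` B; have mE : measurable E by exact: mpre.
pose rect (C : nat -> set R) := \bigcap_(i in `I_k) (xi i @^-1` C i).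
pose G := [set D | exists2 C : nat -> set R, (forall i, measurable (C i)) & D = rect C].
pose H := [set D | measurable D /\ P (D `&` E) = (P D * P E)%E].
have GI : setI_closed G.
  move=> _ _ [C mC ->] [D mD ->]; exists (fun i => C i `&` D i).
    by move=> i; exact: measurableI.
  by rewrite -bigcapI.
have GH : G `<=` H.
  move=> _ [C mC ->]; split.
    by apply: bigcap_measurableType => i _; exact: mpre.
  pose C' (D : set R) (i : 'I_N) :=
    if (i < k)%N then C i else if i == k :> nat then D else setT.
  have C'E D : rect C `&` xi k @^-1` D = \bigcap_(i in [set: 'I_N]) (xi i @^-1` C' D i).
    apply/seteqP; split => w /=.
      move=> [wC wD] i _; rewrite /C'; case: ifPn => [ik|_]; first exact: wC.
      by case: ifPn => [/eqP ->//|_].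
    move=> wC; split.
      move=> i ik; have := wC (Ordinal (ltn_trans ik kN)) I.
      by rewrite /C' /= ik.
    by have := wC (Ordinal kN) I; rewrite /C' /= ltnn eqxx.
  have C'P D : measurable D -> P (rect C `&` xi k @^-1` D) =
     (P (xi k @^-1` D) * \prod_(i < N | i != Ordinal kN) P (xi i @^-1` C' setT i))%E.
    move=> mD; rewrite C'E xiI; last first.
      by move=> i; rewrite /C'; case: ifP => // _; case: ifP.
    rewrite (bigD1 (Ordinal kN))//=; congr (_ * _)%E.
      by rewrite /C' /= ltnn eqxx.
    apply: eq_bigr => i ik; congr (P (_ @^-1` _)).
    rewrite /C'; case: ifP => // _; case: ifP => // /eqP ik'.
    by move/eqP: ik; case; apply/val_inj.
  rewrite /E C'P// muleC; congr (_ * _)%E.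
  by have := C'P setT measurableT; rewrite preimage_setT setIT probability_setT mul1e.
have HL : lambda_system setT H.
  apply/dynkin_lambda_system; split.
  - by split => //; rewrite setTI probability_setT mul1e.
  - move=> D [mD DE]; split; first exact: measurableC.
    rewrite probability_setC// setIC -setDE measureD//; last first.
      by rewrite -ge0_fin_numE// fin_num_measure.
    rewrite [X in (_ - X)%E](_ : _ = P D * P E)%E; last by rewrite setIC.
    by rewrite muleBl ?mul1e//; exact: fin_num_measure.
  - move=> F tF HF; split.
      by apply: bigcup_measurable => i _; have [] := HF i.
    rewrite setI_bigcupl measure_bigcup//=; last 2 first.
    + by move=> i _; apply: measurableI => //; have [] := HF i.
    + by apply: trivIset_setIr.
    rewrite [in RHS]measure_bigcup//; last by move=> i _; have [] := HF i.
    rewrite muleC -(fineK (_ : P E \is a fin_num)) ?fin_num_measure//.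
    rewrite -nneseriesZl//; apply: eq_eseriesr => i _.
    by rewrite fineK ?fin_num_measure// muleC; have [] := HF i.
have sub : <<s G >> `<=` H by exact: lambda_system_subset.
pose T' := g_sigma_algebraType G.
have mZ : measurable_fun setT ((fun w => \sum_(i < k) a i * xi i w) : T' -> R).
  apply: measurable_sum => i; apply: measurable_funM => //.
  move=> _ C mC; rewrite setTI; apply: sub_sigma_algebra.
  exists (fun j : nat => if j == i :> nat then C else setT).
    by move=> j; case: ifP.
  apply/seteqP; split => w /=.
    by move=> wC j _ /=; case: ifP => // /eqP ->.
  by move=> /(_ i (ltn_ord i)) /=; rewrite eqxx.
have := mZ measurableT A mA; rewrite setTI => /sub[_].
by [].
Qed.

End PartialSums.
End Independence.

(** * Fourth moments of sums *)

Section FourthMoments.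
Context (R : realType) (disp : measure_display) (T : measurableType disp).
Variable P : probability T R.
Implicit Types X Y : T -> R.

Definition mom4 X :=
  measurable_fun setT X /\ P.-integrable setT (EFin \o (fun w => X w ^+ 4)).

Definition m4 X : R := \int[P]_w (X w ^+ 4).

(** Because |x|^k <= 1 + x^4. *)
Lemma mom4_pow X k : (k <= 4)%N -> mom4 X ->
  P.-integrable setT (EFin \o (fun w => X w ^+ k)).
Proof.
move=> k4 [mX iX]; apply: (@integrable_le _ _ _ _ _ (fun w => 1 + X w ^+ 4)).
- exact: measurable_funX.
- move=> w; rewrite normrX.
  have -> : X w ^+ 4 = `|X w| ^+ 4 by rewrite -normrX ger0_norm// exprn_even_ge0.
  have [a1|a1] := leP `|X w| 1.
    have : `|X w| ^+ k <= 1 by rewrite exprn_ile1.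
    have : 0 <= `|X w| ^+ 4 by rewrite exprn_ge0.
    lra.
  have : `|X w| ^+ k <= `|X w| ^+ 4 by rewrite ler_weXn2l// ltW.
  lra.
- by apply: integrableD_fun => //; exact: finite_measure_integrable_cst.
Qed.

Lemma mom4_integrable X : mom4 X -> P.-integrable setT (EFin \o X).
Proof. by move=> hX; have := @mom4_pow X 1 isT hX. Qed.

Lemma mom4_sqint X : mom4 X -> sqint P X.
Proof. by move=> hX; split; [case: hX|exact: mom4_pow]. Qed.

Lemma m4_ge0 X : 0 <= m4 X.
Proof. by apply: Rintegral_ge0 => w _; rewrite exprn_even_ge0. Qed.

Lemma mom4D X Y : mom4 X -> mom4 Y -> mom4 (fun w => X w + Y w).
Proof.
move=> [mX iX] [mY iY]; split; first exact: measurable_funD.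
apply: (@integrable_le _ _ _ _ _ (fun w => 8 * X w ^+ 4 + 8 * Y w ^+ 4)).
- by apply: measurable_funX; exact: measurable_funD.
- move=> w; rewrite ger0_norm ?exprn_even_ge0//.
  set x := X w; set y := Y w.
  have h1 : (x + y) ^+ 2 <= 2 * (x ^+ 2 + y ^+ 2) by have := sqr_ge0 (x - y); lra.
  have h2 : ((x + y) ^+ 2) ^+ 2 <= (2 * (x ^+ 2 + y ^+ 2)) ^+ 2.
    by rewrite lerXn2r// nnegrE ?sqr_ge0// mulr_ge0// addr_ge0 ?sqr_ge0.
  have := sqr_ge0 (x ^+ 2 - y ^+ 2).
  have -> : (x + y) ^+ 4 = ((x + y) ^+ 2) ^+ 2 by ring.
  move: h2; lra.
- by apply: integrableD_fun; exact: integrableZ_fun.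
Qed.

Lemma mom4Z (a : R) X : mom4 X -> mom4 (fun w => a * X w).
Proof.
move=> [mX iX]; split; first exact: measurable_funM.
have := integrableZ_fun (a ^+ 4) iX; congr (integrable _ _ _).
by apply/funext => w /=; rewrite exprMn.
Qed.

Lemma m4Z (a : R) X : mom4 X -> m4 (fun w => a * X w) = a ^+ 4 * m4 X.
Proof.
move=> [mX iX]; rewrite /m4 -RintegralZl//.
by apply: eq_Rintegral => w _; rewrite exprMn.
Qed.

Lemma mom4_0 : mom4 (fun=> 0).
Proof.
split => //; have := finite_measure_integrable_cst P 0 measurableT.
by congr (integrable _ _ _); apply/funext => w /=; rewrite expr0n.
Qed.

Lemma indep_pow X Y (j k : nat) : (j <= 4)%N -> (k <= 4)%N ->
  mom4 X -> mom4 Y -> indep P X Y ->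
  P.-integrable setT (EFin \o (fun w => X w ^+ j * Y w ^+ k)) /\
  \int[P]_w (X w ^+ j * Y w ^+ k) =
  (\int[P]_w (X w ^+ j)) * (\int[P]_w (Y w ^+ k)).
Proof.
move=> j4 k4 hX hY XY; have [mX _] := hX; have [mY _] := hY.
apply: (@indep_mean_mul _ _ _ _ (fun w => X w ^+ j) (fun w => Y w ^+ k)).
- exact: measurable_funX.
- exact: measurable_funX.
- exact: (@indep_comp _ _ _ _ _ _ (fun x => x ^+ j) (fun x => x ^+ k)).
- exact: mom4_pow.
- exact: mom4_pow.
Qed.

Section Sum.
Variables X Y : T -> R.
Hypotheses (hX : mom4 X) (hY : mom4 Y) (XY : indep P X Y).
Hypotheses (X0 : \int[P]_w X w = 0) (Y0 : \int[P]_w Y w = 0).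

Lemma mean_indepD : \int[P]_w (X w + Y w) = 0.
Proof. by rewrite RintegralD ?X0 ?Y0 ?addr0//; exact: mom4_integrable. Qed.

Lemma nsq_indepD : nsq P (fun w => X w + Y w) = nsq P X + nsq P Y.
Proof.
rewrite nsqD; [|exact: mom4_sqint|exact: mom4_sqint].
have [_] := @indep_pow X Y 1 1 isT isT hX hY XY.
rewrite [\int[P]_w (X w ^+ 1)](_ : _ = 0) ?mul0r; last first.
  by rewrite -X0; apply: eq_Rintegral => w _; rewrite expr1.
move=> h; rewrite [\int[P]_w (X w * Y w)](_ : _ = 0) ?mulr0 ?addr0//.
Qed.

(** In the binomial expansion the terms with an odd power contain a vanishing
    mean as a factor. *)
Lemma m4_indepD :
  m4 (fun w => X w + Y w) = m4 X + 6 * nsq P X * nsq P Y + m4 Y.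
Proof.
have [i31 e31] := @indep_pow X Y 3 1 isT isT hX hY XY.
have [i22 e22] := @indep_pow X Y 2 2 isT isT hX hY XY.
have [i13 e13] := @indep_pow X Y 1 3 isT isT hX hY XY.
have X1 : \int[P]_w (X w ^+ 1) = 0.
  by rewrite -X0; apply: eq_Rintegral => w _; rewrite expr1.
have Y1 : \int[P]_w (Y w ^+ 1) = 0.
  by rewrite -Y0; apply: eq_Rintegral => w _; rewrite expr1.
rewrite Y1 mulr0 in e31; rewrite X1 mul0r in e13.
have iX4 : P.-integrable setT (EFin \o (fun w => X w ^+ 4)) by exact: mom4_pow.
have iY4 : P.-integrable setT (EFin \o (fun w => Y w ^+ 4)) by exact: mom4_pow.
rewrite /m4 (_ : (fun w => (X w + Y w) ^+ 4) = (fun w => X w ^+ 4 +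
   (4 * (X w ^+ 3 * Y w ^+ 1) + (6 * (X w ^+ 2 * Y w ^+ 2) +
   (4 * (X w ^+ 1 * Y w ^+ 3) + Y w ^+ 4))))); last first.
  by apply/funext => w; ring.
have j31 := integrableZ_fun 4 i31.
have j22 := integrableZ_fun 6 i22.
have j13 := integrableZ_fun 4 i13.
have j1 := integrableD_fun j13 iY4.
have j2 := integrableD_fun j22 j1.
have j3 := integrableD_fun j31 j2.
rewrite RintegralD// RintegralD// RintegralD// RintegralD//.
rewrite !RintegralZl// e31 e22 e13 /nsq; ring.
Qed.

End Sum.
End FourthMoments.

Section SameLaw.
Context (R : realType) (disp : measure_display) (T : measurableType disp).
Variable P : probability T R.
Variables X Y : T -> R.
Hypotheses (mX : measurable_fun setT X) (mY : measurable_fun setT Y).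
Hypothesis XY : forall B : set R, measurable B -> P (X @^-1` B) = P (Y @^-1` B).

Lemma same_law_integral (f : R -> \bar R) : measurable_fun setT f ->
  (forall x, 0 <= f x)%E -> (\int[P]_w f (X w) = \int[P]_w f (Y w))%E.
Proof.
move=> mf f0.
pose Xm : {mfun T >-> R} := HB.pack X (isMeasurableFun.Build _ _ _ _ _ mX).
pose Ym : {mfun T >-> R} := HB.pack Y (isMeasurableFun.Build _ _ _ _ _ mY).
have := @ge0_integral_distribution _ _ _ _ _ P Xm f mf f0.
have := @ge0_integral_distribution _ _ _ _ _ P Ym f mf f0.
rewrite /= => <- <-.
by apply: eq_measure_integral => A mA _; exact: XY.
Qed.

(** Even powers are nonnegative, so equality of the integrals needs no prior
    integrability of X and integrability can be deduced from it. *)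
Lemma same_law_pow (k : nat) : ~~ odd k ->
  P.-integrable setT (EFin \o (fun w => Y w ^+ k)) ->
  P.-integrable setT (EFin \o (fun w => X w ^+ k)) /\
  \int[P]_w (X w ^+ k) = \int[P]_w (Y w ^+ k).
Proof.
move=> ok iY.
have e := @same_law_integral (fun x => (x ^+ k)%:E).
have {}e : (\int[P]_w (X w ^+ k)%:E = \int[P]_w (Y w ^+ k)%:E)%E.
  apply: e; first by apply/measurable_EFinP; exact: measurable_funX.
  by move=> x; rewrite lee_fin exprn_even_ge0.
split; last by rewrite /Rintegral e.
have abs (Z : T -> R) : (\int[P]_w `|(Z w ^+ k)%:E| = \int[P]_w (Z w ^+ k)%:E)%E.
  by apply: eq_integral => w _; rewrite gee0_abs// lee_fin exprn_even_ge0.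
apply/integrableP; split.
  by apply/measurable_EFinP; exact: measurable_funX.
rewrite /= abs e -abs.
by have /integrableP[] := iY.
Qed.

End SameLaw.

(** * Moments of a Lévy process *)

Section ArchimedeanLimits.
Variable R : realType.

Lemma eq_of_small (a b c : R) :
  (forall N : nat, (0 < N)%N -> `|a - b| <= c / N%:R) -> a = b.
Proof.
move=> H; apply/eqP; rewrite -subr_eq0 -normr_le0 leNgt; apply/negP => ab.
pose N := (Num.trunc (c / `|a - b|)).+1.
have N0 : 0 < N%:R :> R by rewrite ltr0n.
have : c / `|a - b| < N%:R by exact: truncnS_gt.
rewrite ltr_pdivrMr// => cN.
have := H N isT; rewrite ler_pdivlMr// mulrC.
by move=> /le_lt_trans/(_ cN); rewrite ltxx.
Qed.

(** Such a v is nondecreasing, so v t lies between its values at the multiples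
    of 1/N that surround t. *)
Lemma additive_nonneg_linear (v : R -> R) :
  (forall t, 0 <= t -> 0 <= v t) ->
  (forall s t, 0 <= s -> 0 <= t -> v (s + t) = v s + v t) ->
  forall t, 0 <= t -> v t = t * v 1.
Proof.
move=> v0 vD.
have vn (n : nat) t : 0 <= t -> v (n%:R * t) = n%:R * v t.
  move=> t0; elim: n => [|n IH].
    by have := vD 0 0 (lexx _) (lexx _); rewrite addr0 !mul0r => h; lra.
  by rewrite -natr1 mulrDl mul1r vD ?IH ?mulrDl ?mul1r// mulr_ge0.
have vm s t : 0 <= s -> s <= t -> v s <= v t.
  move=> s0 st; have -> : t = s + (t - s) by ring.
  by rewrite vD ?subr_ge0// lerDl v0// subr_ge0.
move=> t t0; apply: (@eq_of_small _ _ (v 1)) => N N0.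
have N0' : 0 < N%:R :> R by rewrite ltr0n.
have Nt : 0 <= N%:R * t by rewrite mulr_ge0.
set k := Num.trunc (N%:R * t).
have /andP[k1 k2] : k%:R <= N%:R * t < k.+1%:R by exact: truncn_itv.
have Nv : N%:R * v t = v (N%:R * t) by rewrite vn.
have h1 : k%:R * v 1 <= N%:R * v t.
  by rewrite Nv -(vn _ _ (ler01)) vm ?mulr1.
have h2 : N%:R * v t <= k.+1%:R * v 1.
  by rewrite Nv -(vn _ _ (ler01)) vm ?mulr1// ltW.
have v1 : 0 <= v 1 by rewrite v0.
have Nv1 : k%:R * v 1 <= N%:R * t * v 1 by rewrite ler_wpM2r.
have Nv2 : N%:R * t * v 1 <= k.+1%:R * v 1 by rewrite ler_wpM2r// ltW.
rewrite -natr1 in h2 Nv2.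
rewrite ler_pdivlMr// -[X in _ * X](ger0_norm (ltW N0')) -normrM ler_norml.
apply/andP; split; lra.
Qed.

End ArchimedeanLimits.

Section LevyMoments.
Context (R : realType) (disp : measure_display) (T : measurableType disp).
Variable P : probability T R.
Variable L : R -> {RV P >-> R}.
Hypothesis hL : two_sided_levy L.
Hypothesis hL_mean : forall t, ('E_P[L t] = 0)%E.
Hypothesis hL_fourth : forall t, ('E_P[(fun w => L t w ^+ 4)%R] < +oo)%E.

Definition incr (s t : R) (w : T) : R := L t w - L s w.

Definition levy_var : R := nsq P (L 1).

Lemma mom4_levy t : mom4 P (L t).
Proof.
split => //; apply/integrableP; split.
  by apply/measurable_EFinP; exact: measurable_funX.
have := hL_fourth t; rewrite unlock; congr (_ < _)%E.
by apply: eq_integral => w _; rewrite /= ger0_norm ?exprn_even_ge0.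
Qed.

Lemma mean_levy t : \int[P]_w (L t w) = 0.
Proof. by have := hL_mean t; rewrite unlock /Rintegral => ->. Qed.

Lemma mom4_incr s t : mom4 P (incr s t).
Proof.
have := mom4D (mom4_levy t) (mom4Z (-1) (mom4_levy s)); congr (mom4 _ _).
by apply/funext => w; rewrite mulN1r.
Qed.

Lemma mean_incr s t : \int[P]_w (incr s t w) = 0.
Proof.
by rewrite RintegralB ?mean_levy ?subrr//; exact/mom4_integrable/mom4_levy.
Qed.

Lemma incr0 t : incr 0 t = L t.
Proof. by apply/funext => w; rewrite /incr; have [_ _ _ ->] := hL; rewrite subr0. Qed.

Lemma incr_law s t (k : nat) : s <= t -> (k <= 4)%N -> ~~ odd k ->
  \int[P]_w (incr s t w ^+ k) = \int[P]_w (L (t - s) w ^+ k).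
Proof.
move=> st k4 ok.
apply: (@same_law_pow _ _ _ P (incr s t) (L (t - s)) _ _ _ k ok _).2.
- by have [] := mom4_incr s t.
- by [].
- move=> B mB; have [_ stat _ _] := hL.
  have := stat 0 (t - s) s B; rewrite subr_ge0 => /(_ st mB).
  by rewrite subrK add0r -/(incr s t) -/(incr 0 (t - s)) incr0.
- by apply: mom4_pow => //; exact: mom4_levy.
Qed.

Lemma incr_indep s t : 0 < s -> 0 < t -> indep P (L s) (incr s (s + t)).
Proof.
move=> s0 t0; have [ind _ _ _] := hL.
(* The subdivision 0 < s < s + t. *)
pose p (i : nat) : R := if i == 0%N then 0 else if i == 1%N then s else s + t.
have pI i : (i < 2)%N -> p i < p i.+1.
  by rewrite /p; case: i => [|[|//]] _ //=; rewrite ltrDl.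
have := ind 2 p pI.
have mx i : measurable_fun setT (fun w => L (p i.+1) w - L (p i) w).
  exact: measurable_funB.
move=> h; have := @indep_sum _ _ _ P (fun i w => L (p i.+1) w - L (p i) w) 2 mx h
  (fun=> 1) 1 isT.
rewrite (_ : (fun w => \sum_(i < 1) _) = L s)//.
apply/funext => w; rewrite big_ord1 /p/= mul1r.
by have [_ _ _ ->] := hL; rewrite subr0.
Qed.

Lemma levyD s t w : L (s + t) w = L s w + incr s (s + t) w.
Proof. by rewrite /incr addrCA subrr addr0. Qed.

Lemma levy0_pow k : (0 < k)%N -> \int[P]_w (L 0 w ^+ k) = 0.
Proof.
move=> k0; rewrite -[RHS](@Rintegral_cstP _ _ _ P 0).
by apply: eq_Rintegral => w _; have [_ _ _ ->] := hL; rewrite expr0n; case: k k0.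
Qed.

(** The increment over ]s, s + t] is independent of L_s and has the law of
    L_t. *)
Lemma levy_moments_add s t : 0 <= s -> 0 <= t ->
  nsq P (L (s + t)) = nsq P (L s) + nsq P (L t) /\
  m4 P (L (s + t)) = m4 P (L s) + 6 * nsq P (L s) * nsq P (L t) + m4 P (L t).
Proof.
rewrite le_eqVlt => /predU1P[<- _|s0].
  by rewrite add0r /nsq /m4 !levy0_pow// !add0r mulr0 mul0r add0r.
rewrite le_eqVlt => /predU1P[<-|t0].
  by rewrite addr0 /nsq /m4 !levy0_pow// !addr0 mulr0 addr0.
have st : s <= s + t by rewrite lerDl ltW.
have e2 : nsq P (incr s (s + t)) = nsq P (L t).
  by have := incr_law st (isT : (2 <= 4)%N) isT; rewrite (addrC s) addrK.
have e4 : m4 P (incr s (s + t)) = m4 P (L t).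
  by have := incr_law st (isT : (4 <= 4)%N) isT; rewrite (addrC s) addrK.
rewrite -e2 -e4.
have -> : (L (s + t) : T -> R) = (fun w => L s w + incr s (s + t) w).
  by apply/funext => w; exact: levyD.
have h4 := mom4_levy s; have i4 := mom4_incr s (s + t).
have ind := incr_indep s0 t0; have m0 := mean_levy s.
have i0 := mean_incr s (s + t).
by split; [exact: nsq_indepD|exact: m4_indepD].
Qed.

Lemma levy_nsq t : 0 <= t -> nsq P (L t) = t * levy_var.
Proof.
move=> t0; apply: (@additive_nonneg_linear _ (fun t => nsq P (L t))) => //.
  by move=> u _; exact: nsq_ge0.
by move=> a b a0 b0; have [] := levy_moments_add a0 b0.
Qed.

Lemma levy_var_ge0 : 0 <= levy_var. Proof. exact: nsq_ge0. Qed.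

Lemma levy_m4_mono s t : 0 <= s -> s <= t -> m4 P (L s) <= m4 P (L t).
Proof.
move=> s0 st; have -> : t = s + (t - s) by ring.
have ts : 0 <= t - s by rewrite subr_ge0.
have [_ ->] := levy_moments_add s0 ts.
rewrite -addrA lerDl addr_ge0 ?m4_ge0// mulr_ge0 ?nsq_ge0// mulr_ge0// nsq_ge0.
by [].
Qed.

(** The part of the fourth moment beyond the Gaussian one is additive in time;
    the second summand collects the products of variances of distinct pieces. *)
Lemma levy_m4_muln (n : nat) u : 0 <= u ->
  m4 P (L (n%:R * u)) =
  n%:R * m4 P (L u) + 3 * n%:R * (n%:R - 1) * (u * levy_var) ^+ 2.
Proof.
move=> u0; elim: n => [|n IH].
  by rewrite !mul0r /m4 levy0_pow// mulr0 !mul0r addr0.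
rewrite -natr1 mulrDl mul1r.
have nu : 0 <= n%:R * u by rewrite mulr_ge0.
have [_ ->] := levy_moments_add nu u0.
rewrite IH !levy_nsq//; ring.
Qed.

(** For u <= 1 about 1/u independent increments of length u fit into [0, 1], so
    each of them has fourth moment at most 2 u E L_1^4; a longer interval is cut
    into pieces of length at most 1. *)
Lemma levy_m4_bound : exists2 K : R, 0 <= K &
  forall t, 0 <= t -> m4 P (L t) <= K * (t + t ^+ 2).
Proof.
pose M := m4 P (L 1); have M0 : 0 <= M by exact: m4_ge0.
have V0 := levy_var_ge0.
have small u : 0 <= u -> u <= 1 -> m4 P (L u) <= 2 * M * u.
  rewrite le_eqVlt => /predU1P[<- _|u0 u1].
    by rewrite mulr0 /m4 levy0_pow.
  pose n := Num.trunc u^-1.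
  have ui : 0 <= u^-1 by rewrite invr_ge0 ltW.
  have /andP[n1 n2] : n%:R <= u^-1 < n.+1%:R by exact: truncn_itv.
  have nu1 : n%:R * u <= 1 by rewrite -ler_pdivlMr// mul1r.
  have nu2 : 1 < n.+1%:R * u by rewrite -ltr_pdivrMr// mul1r.
  have n0 : (0 < n)%N by rewrite truncn_gt0 invf_ge1.
  have n0' : 1 <= n%:R :> R by rewrite ler1n.
  have : m4 P (L (n%:R * u)) <= M.
    by apply: levy_m4_mono => //; rewrite mulr_ge0// ltW.
  rewrite (levy_m4_muln _ (ltW u0)) => h.
  have h2 : n%:R * m4 P (L u) <= M.
    apply: le_trans h; rewrite lerDl !mulr_ge0 ?sqr_ge0//; lra.
  rewrite -natr1 in nu2.
  have h3 : 1 <= 2 * (n%:R * u) by nra.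
  have m40 := m4_ge0 P (L u).
  have h4 : m4 P (L u) <= 2 * (n%:R * u) * m4 P (L u) by rewrite ler_peMl.
  apply: le_trans h4 _.
  have -> : 2 * (n%:R * u) * m4 P (L u) = 2 * u * (n%:R * m4 P (L u)) by ring.
  have -> : 2 * M * u = 2 * u * M by ring.
  by rewrite ler_wpM2l// mulr_ge0// ltW.
exists (2 * M + 3 * levy_var ^+ 2).
  by rewrite addr_ge0// mulr_ge0// sqr_ge0.
move=> t t0; pose n := (Num.trunc t).+1.
have tn : t < n%:R by exact: truncnS_gt.
have n0 : 0 < n%:R :> R by rewrite ltr0n.
pose u := t / n%:R.
have u0 : 0 <= u by rewrite divr_ge0// ltW.
have u1 : u <= 1 by rewrite ler_pdivrMr// mul1r ltW.
have tE : t = n%:R * u by rewrite /u mulrC divfK// gt_eqF.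
rewrite {1}tE levy_m4_muln//.
have h1 := small u u0 u1.
have : n%:R * m4 P (L u) <= 2 * M * t.
  have -> : 2 * M * t = n%:R * (2 * M * u) by rewrite [in LHS]tE; ring.
  by rewrite ler_pM2l.
have -> : 3 * n%:R * (n%:R - 1) * (u * levy_var) ^+ 2 =
  3 * levy_var ^+ 2 * (t ^+ 2 - t * u) by rewrite tE; ring.
have W0 : 0 <= levy_var ^+ 2 by exact: sqr_ge0.
have : 0 <= levy_var ^+ 2 * (t * u) by rewrite !mulr_ge0.
have : 0 <= levy_var ^+ 2 * t by rewrite mulr_ge0.
have : 0 <= M * t ^+ 2 by rewrite mulr_ge0 ?sqr_ge0.
lra.
Qed.

Lemma incr_nsq s t : s <= t -> nsq P (incr s t) = (t - s) * levy_var.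
Proof.
by move=> st; rewrite -levy_nsq ?subr_ge0// /nsq (incr_law st).
Qed.

Lemma incr_m4 s t : s <= t -> m4 P (incr s t) = m4 P (L (t - s)).
Proof. by move=> st; rewrite /m4 (incr_law st). Qed.

Lemma nsq_eq0_ae (X : T -> R) : sqint P X -> nsq P X = 0 ->
  {ae P, forall w, X w = 0}.
Proof.
move=> [mX iX] X0.
have mX2 : measurable_fun setT (fun w => (X w ^+ 2)%:E).
  by apply/measurable_EFinP; exact: measurable_funX.
have : (\int[P]_w `|(X w ^+ 2)%:E| = 0)%E.
  rewrite -[LHS]fineK; last first.
    by apply: integrable_fin_num => //; exact: integrable_abse.
  congr EFin; rewrite -X0; congr fine; apply: eq_integral => w _.
  by rewrite gee0_abs// lee_fin sqr_ge0.
move/(ae_eq_integral_abs P measurableT mX2); apply: filterS => w /= /(_ I).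
by move=> [] /eqP; rewrite sqrf_eq0 => /eqP.
Qed.

Lemma levy_var_gt0 : ~ (forall t, {ae P, forall w, L t w = 0}) -> 0 < levy_var.
Proof.
move=> nz; rewrite lt_neqAle levy_var_ge0 andbT; apply/negP => /eqP V0.
apply: nz => t; apply: nsq_eq0_ae; first exact/mom4_sqint/mom4_levy.
have [t0|/ltW t0] := leP 0 t; first by rewrite levy_nsq// -V0 mulr0.
rewrite (@nsq_eq _ _ _ _ _ (fun w => (-1) * incr t 0 w)).
  by rewrite nsqZ ?incr_nsq// -?V0 ?mulr0//; exact/mom4_sqint/mom4_incr.
by move=> w; rewrite /incr; have [_ _ _ ->] := hL; ring.
Qed.

End LevyMoments.

(** * Step functions on grids and the isometry *)

Section Grids.
Variable R : realType.

Definition grid_code (v p : nat -> R) (N : nat) : seq (R * (R * R)) :=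
  [seq (v i, (p i, p i.+1)) | i <- iota 0 N].

Definition grid (p : nat -> R) (N : nat) := forall i, (i < N)%N -> p i < p i.+1.

Lemma grid_le p N i j : grid p N -> (i <= j <= N)%N -> p i <= p j.
Proof.
move=> pN /andP[ij jN]; rewrite -(subnKC ij).
have : (i + (j - i) <= N)%N by rewrite subnKC.
elim: (j - i)%N => [|k IH]; first by rewrite addn0.
rewrite addnS => kN; apply: le_trans (IH (ltnW kN)) _.
exact/ltW/pN.
Qed.

Lemma big_grid (v p : nat -> R) N (F : R * (R * R) -> R) :
  \sum_(q <- grid_code v p N) F q = \sum_(i < N) F (v i, (p i, p i.+1)).
Proof. by rewrite big_map -{1}(subn0 N) -/(index_iota 0 N) big_mkord. Qed.

Lemma grid_code_ok v p N : grid p N -> step_code_ok (grid_code v p N).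
Proof.
move=> pN; rewrite /step_code_ok all_map; apply/allP => i /=.
by rewrite mem_iota => /andP[_ iN]; exact/ltW/pN.
Qed.

(** The grid consists of the sorted end points of the intervals, and each
    interval is a telescoping sum of grid cells.  The identity is stated for an
    arbitrary path l because it serves twice: the paths of L give the integrals,
    and the paths u |-> 1_(x <= u) give the step functions. *)
Lemma refine_code (c : seq (R * (R * R))) : exists p N (v : nat -> R), grid p N /\
  forall l : R -> R,
  \sum_(q <- c) q.1 * (l q.2.2 - l q.2.1) =
  \sum_(i < N) v i * (l (p i.+1) - l (p i)).
Proof.
pose pts := sort <=%R (undup ([seq q.2.1 | q <- c] ++ [seq q.2.2 | q <- c])).
pose p i := nth 0 pts i.
have ptsS : sorted <%R pts.
  by rewrite lt_sorted_uniq_le sort_uniq undup_uniq sort_le_sorted.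
have pmono i j : (i < size pts)%N -> (j < size pts)%N -> (p i <= p j) = (i <= j)%N.
  by move=> ip jp; rewrite /p lt_sorted_leq_nth.
pose N := (size pts).-1.
have NS i : (i < N)%N -> (i.+1 < size pts)%N by rewrite /N; case: (size pts).
have pN : grid p N.
  move=> i /NS iN; rewrite ltNge pmono ?ltnn//; exact: ltn_trans iN.
pose b (i : nat) (t : R) : R := (p i.+1 <= t)%R%:R.
exists p, N, (fun i => \sum_(q <- c) q.1 * (b i q.2.2 - b i q.2.1)).
split => // l.
have tel t : t \in pts ->
    \sum_(i < N) b i t * (l (p i.+1) - l (p i)) = l t - l (p 0%N).
  move=> tp; pose k := index t pts.
  have kp : (k < size pts)%N by rewrite index_mem.
  have tE : t = p k by rewrite /p nth_index.
  have kN : (k <= N)%N by rewrite /N; case: (size pts) kp.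
  rewrite {2}tE -[RHS](telescope_sumr (fun i => l (p i)) (leq0n k)).
  rewrite big_mkord (big_ord_widen _ (fun i => l (p i.+1) - l (p i)) kN).
  rewrite [RHS]big_mkcond/=; apply: eq_bigr => i _.
  rewrite /b tE pmono//; last exact: NS.
  by case: ltnP => _; rewrite ?mul1r ?mul0r.
under [RHS]eq_bigr do rewrite big_distrl/=.
rewrite exchange_big/=; apply: eq_big_seq => q qc.
under eq_bigr do rewrite -mulrA mulrBl.
rewrite -big_distrr/= sumrB !tel; first by congr (_ * _); ring.
- by rewrite mem_sort mem_undup mem_cat; apply/orP; left; apply/mapP; exists q.
- by rewrite mem_sort mem_undup mem_cat; apply/orP; right; apply/mapP; exists q.
Qed.

Lemma indic_itvoc (s t x : R) : s <= t ->
  \1_(`]s, t]%classic : set R) x = (x <= t)%R%:R - (x <= s)%R%:R :> R.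
Proof.
move=> st; rewrite indicE mem_setE in_itv/=.
have [xs|sx] := leP x s; first by rewrite (le_trans xs st) subrr.
by rewrite subr0.
Qed.

Lemma step_funE (c : seq (R * (R * R))) x : step_code_ok c ->
  step_fun c x = \sum_(q <- c) q.1 * ((x <= q.2.2)%R%:R - (x <= q.2.1)%R%:R).
Proof.
move=> /allP ok; apply: eq_big_seq => q qc.
by rewrite indic_itvoc ?ok.
Qed.

Lemma refine_grid (c : seq (R * (R * R))) : step_code_ok c ->
  exists v p N, [/\ grid p N,
    (forall x, step_fun (grid_code v p N) x = step_fun c x)
    & forall (disp : measure_display) (T : measurableType disp)
        (P : probability T R) (L : R -> {RV P >-> R}) w,
        step_integral L (grid_code v p N) w = step_integral L c w].
Proof.
move=> ok; have [p [N [v [pN H]]]] := refine_code c.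
exists v, p, N; split => //.
  move=> x; rewrite !step_funE//; last exact: grid_code_ok.
  by rewrite (H (fun u => (x <= u)%R%:R)) big_grid.
by move=> d T P L w; rewrite /step_integral (H (fun u => L u w)) big_grid.
Qed.

(** Off the grid all terms vanish, and on it exactly one does not. *)
Lemma grid_fun_comp (v p : nat -> R) N (phi : R -> R) x : grid p N -> phi 0 = 0 ->
  phi (step_fun (grid_code v p N) x) = step_fun (grid_code (phi \o v) p N) x.
Proof.
move=> pN phi0; rewrite /step_fun !big_grid/=.
pose A (i : 'I_N) := p i < x <= p i.+1.
have E (i : 'I_N) : \1_(`]p i, p i.+1]%classic : set R) x = (A i)%:R :> R.
  by rewrite indicE mem_setE in_itv.
under eq_bigr do rewrite E.
under [RHS]eq_bigr do rewrite E.
have [[i Ai]|nA] := pselect (exists i, A i).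
  have other j : j != i -> A j = false.
    move=> ji; apply/negP => Aj; move: Ai Aj => /andP[xi1 xi2] /andP[xj1 xj2].
    have : (i < j)%N || (j < i)%N by rewrite -neq_ltn eq_sym; exact: ji.
    case/orP => ij.
      have := grid_le pN (_ : (i.+1 <= j <= N)%N); rewrite ij ltnW ?ltn_ord//.
      by move=> /(_ isT) h; move: (lt_le_trans xj1 (le_trans xi2 h)); rewrite ltxx.
    have := grid_le pN (_ : (j.+1 <= i <= N)%N); rewrite ij ltnW ?ltn_ord//.
    by move=> /(_ isT) h; move: (lt_le_trans xi1 (le_trans xj2 h)); rewrite ltxx.
  rewrite (bigD1 i)//= [in RHS](bigD1 i)//= Ai !mulr1.
  rewrite !big1 ?addr0// => j ji; rewrite (other _ ji) mulr0//.
rewrite !big1 ?phi0// => i _; case: (boolP (A i)) => [Ai|_]; rewrite ?mulr0//.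
- by exfalso; apply: nA; exists i.
- by exfalso; apply: nA; exists i.
Qed.

Notation leb := (@lebesgue_measure R).

Lemma integrable_step (c : seq (R * (R * R))) :
  leb.-integrable setT (EFin \o step_fun c).
Proof.
apply: integrable_sum_fun => q; apply: integrableZ_fun.
exact: integrable_indic_itv.
Qed.

Lemma Rintegral_indic_itvoc (a b : R) : a <= b ->
  \int[leb]_x (\1_(`]a, b]%classic : set R) x) = b - a.
Proof.
move=> ab; rewrite /Rintegral integral_indic// setIT.
apply: (etrans (congr1 fine (lebesgue_measure_itv `]a, b]))); rewrite /=.
rewrite lte_fin; move: ab; rewrite le_eqVlt => /predU1P[->|->]//=.
by rewrite ltxx subrr.
Qed.

Lemma Rintegral_step (c : seq (R * (R * R))) : step_code_ok c ->
  \int[leb]_x (step_fun c x) = \sum_(q <- c) q.1 * (q.2.2 - q.2.1).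
Proof.
move=> /allP ok; rewrite Rintegral_sum; last first.
  by move=> q; apply: integrableZ_fun; exact: integrable_indic_itv.
apply: eq_big_seq => q qc; rewrite RintegralZl//; last exact: integrable_indic_itv.
by rewrite Rintegral_indic_itvoc// ok.
Qed.

Lemma measurable_step (c : seq (R * (R * R))) : measurable_fun setT (step_fun c).
Proof. by apply/measurable_EFinP; exact: measurable_int (integrable_step c). Qed.

Lemma grid_fun_sqr v p N x : grid p N ->
  step_fun (grid_code v p N) x ^+ 2 = step_fun (grid_code (fun i => v i ^+ 2) p N) x.
Proof.
by move=> pN; rewrite (@grid_fun_comp v p N (fun y => y ^+ 2))// expr0n.
Qed.

Lemma sqint_step c : step_code_ok c -> sqint leb (step_fun c).
Proof.
move=> ok; have [v [p [N [pN fE _]]]] := refine_grid ok.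
split; first exact: measurable_step.
have := integrable_step (grid_code (fun i => v i ^+ 2) p N).
congr (integrable _ _ _); apply/funext => x /=.
by rewrite -grid_fun_sqr// fE.
Qed.

Lemma nsq_grid v p N : grid p N ->
  nsq leb (step_fun (grid_code v p N)) = \sum_(i < N) v i ^+ 2 * (p i.+1 - p i).
Proof.
move=> pN; rewrite /nsq; under eq_Rintegral do rewrite grid_fun_sqr//.
by rewrite Rintegral_step ?big_grid//; exact: grid_code_ok.
Qed.

End Grids.

Section Isometry.
Context (R : realType) (disp : measure_display) (T : measurableType disp).
Variable P : probability T R.
Variable L : R -> {RV P >-> R}.
Hypothesis hL : two_sided_levy L.
Hypothesis hL_mean : forall t, ('E_P[L t] = 0)%E.
Hypothesis hL_fourth : forall t, ('E_P[(fun w => L t w ^+ 4)%R] < +oo)%E.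
Notation leb := (@lebesgue_measure R).
Notation V := (levy_var L).

(** Induction on k: each step adds an increment that is independent of the
    preceding sum.  The factor 3 in front of the square absorbs the cross term
    6 E Z^2 E X^2. *)
Lemma grid_partial_sum (v p : nat -> R) N k : grid p N -> (k <= N)%N ->
  let Z w := \sum_(i < k) v i * incr L (p i) (p i.+1) w in
  let A := \sum_(i < k) v i ^+ 2 * (p i.+1 - p i) in
  [/\ mom4 P Z, \int[P]_w Z w = 0, nsq P Z = A * V &
      m4 P Z <= \sum_(i < k) v i ^+ 4 * m4 P (L (p i.+1 - p i)) + 3 * (A * V) ^+ 2].
Proof.
move=> pN; elim: k => [|k IH] kN /=.
  rewrite !big_ord0 (_ : (fun=> _) = fun=> 0); last first.
    by apply/funext => w; rewrite big_ord0.
  rewrite /nsq /m4 !expr0n/= !mul0r expr0n/= mulr0 addr0 !Rintegral_cstP.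
  by split => //; exact: mom4_0.
have [hZ Z0 Z2 Z4] := IH (ltnW kN).
pose Z w := \sum_(i < k) v i * incr L (p i) (p i.+1) w.
pose X w := v k * incr L (p k) (p k.+1) w.
have -> : (fun w => \sum_(i < k.+1) v i * incr L (p i) (p i.+1) w) =
          (fun w => Z w + X w).
  by apply/funext => w; rewrite big_ord_recr.
have mI s t : measurable_fun setT (incr L s t) by exact: measurable_funB.
have hI := mom4_incr hL_fourth (p k) (p k.+1).
have ZX : indep P Z X.
  have [ind _ _ _] := hL.
  have := @indep_sum _ _ _ P (fun i => incr L (p i) (p i.+1)) N
    (fun i => mI _ _) (ind N p pN) v k kN.
  apply: (@indep_comp _ _ _ _ _ _ id (fun x => v k * x)) => //.
  exact: measurable_funM.
have hX : mom4 P X by exact: mom4Z.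
have X0 : \int[P]_w X w = 0.
  rewrite RintegralZl//; last exact: mom4_integrable.
  by rewrite mean_incr// mulr0.
have pk : p k <= p k.+1 by exact/ltW/pN.
have X2 : nsq P X = v k ^+ 2 * (p k.+1 - p k) * V.
  by rewrite nsqZ ?incr_nsq ?mulrA//; exact: mom4_sqint.
have X4 : m4 P X = v k ^+ 4 * m4 P (L (p k.+1 - p k)).
  by rewrite m4Z// incr_m4.
split.
- exact: mom4D.
- exact: mean_indepD.
- by rewrite nsq_indepD// Z2 X2 big_ord_recr/= mulrDl.
- rewrite m4_indepD// X4 X2 Z2 !big_ord_recr/=.
  move: Z4; set S4 := \sum_(i < k) _; set A := \sum_(i < k) _.
  set b := v k ^+ 2 * _; set x := v k ^+ 4 * _ => Z4.
  apply: (@le_trans _ _ (S4 + 3 * (A * V) ^+ 2 + 6 * (A * V) * (b * V) + x)).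
    by rewrite !lerD2r.
  have -> : S4 + x + 3 * ((A + b) * V) ^+ 2 =
    S4 + 3 * (A * V) ^+ 2 + 6 * (A * V) * (b * V) + x + 3 * (b * V) ^+ 2 by ring.
  by rewrite lerDl mulr_ge0 ?sqr_ge0.
Qed.

Lemma step_integral_grid (v p : nat -> R) N w : step_integral L (grid_code v p N) w =
  \sum_(i < N) v i * incr L (p i) (p i.+1) w.
Proof. by rewrite /step_integral big_grid. Qed.

Lemma step_isometry c : step_code_ok c ->
  [/\ mom4 P (step_integral L c), \int[P]_w step_integral L c w = 0
  & nsq P (step_integral L c) = nsq leb (step_fun c) * V].
Proof.
move=> ok; have [v [p [N [pN fE iE]]]] := refine_grid ok.
have [hZ Z0 Z2 _] := grid_partial_sum v pN (leqnn N).
have sE : step_integral L c =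
    (fun w => \sum_(i < N) v i * incr L (p i) (p i.+1) w).
  by apply/funext => w; rewrite -iE step_integral_grid.
split; rewrite ?sE// Z2 -nsq_grid//.
by congr (_ * _); exact: nsq_eq.
Qed.

(** The terms v_i^4 D_i and v_i^4 D_i^2, for cells of length D_i, are bounded by
    B^2 (v_i^2 D_i) and F (v_i^2 D_i), and the sum of v_i^2 D_i is F. *)
Lemma m4_grid : exists2 K : R, 0 <= K & forall (v p : nat -> R) N (B : R), grid p N ->
  (forall i, `|v i| <= B) ->
  let F := nsq leb (step_fun (grid_code v p N)) in
  m4 P (step_integral L (grid_code v p N)) <= K * (B ^+ 2 * F + F ^+ 2).
Proof.
have [K K0 hK] := levy_m4_bound hL hL_mean hL_fourth.
have V0 : 0 <= V by exact: levy_var_ge0.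
exists (K + 3 * V ^+ 2); first by rewrite addr_ge0// mulr_ge0// sqr_ge0.
move=> v p N B pN vB /=; set F := nsq _ _.
have [_ _ _ Z4] := grid_partial_sum v pN (leqnn N).
rewrite (_ : step_integral _ _ =
    (fun w => \sum_(i < N) v i * incr L (p i) (p i.+1) w)); last first.
  by apply/funext => w; rewrite step_integral_grid.
apply: le_trans Z4 _; rewrite -nsq_grid// -/F.
have F0 : 0 <= F by exact: nsq_ge0.
pose a (i : 'I_N) := v i ^+ 2 * (p i.+1 - p i).
have a0 i : 0 <= a i by rewrite mulr_ge0 ?sqr_ge0// subr_ge0; exact/ltW/pN.
have Fa : F = \sum_(i < N) a i by rewrite /F nsq_grid.
have aF i : a i <= F by rewrite Fa (bigD1 i)//= lerDl sumr_ge0.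
have : \sum_(i < N) v i ^+ 4 * m4 P (L (p i.+1 - p i)) <=
       \sum_(i < N) (K * B ^+ 2 * a i + K * F * a i).
  apply: ler_sum => i _.
  have d0 : 0 <= p i.+1 - p i by rewrite subr_ge0; exact/ltW/pN.
  apply: (@le_trans _ _ (v i ^+ 4 * (K * ((p i.+1 - p i) + (p i.+1 - p i) ^+ 2)))).
    by rewrite ler_wpM2l ?hK// exprn_even_ge0.
  have -> : v i ^+ 4 * (K * ((p i.+1 - p i) + (p i.+1 - p i) ^+ 2)) =
    K * v i ^+ 2 * a i + K * a i * a i by rewrite /a; ring.
  have vB2 : v i ^+ 2 <= B ^+ 2.
    by rewrite -(real_normK (num_real (v i))) lerXn2r ?nnegrE// (le_trans _ (vB i)).
  rewrite lerD//.
    by rewrite ler_wpM2r// ler_wpM2l.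
  by rewrite ler_wpM2r// ler_wpM2l.
rewrite big_split/= -!big_distrr/= -Fa => h.
have VF : 0 <= V ^+ 2 * (B ^+ 2 * F) by apply: mulr_ge0; [|apply: mulr_ge0] => //; exact: sqr_ge0.
apply: le_trans (lerD h (lexx _)) _.
rewrite -subr_ge0 (_ : _ - _ = 3 * (V ^+ 2 * (B ^+ 2 * F))); last by ring.
by rewrite mulr_ge0.
Qed.

End Isometry.

(** * The L^2 integral *)

Lemma ereal_cvg0_le (R : realType) (u : nat -> \bar R) (e : R) :
  u n @[n --> \oo] --> 0%E -> 0 < e ->
  exists N, forall n, (N <= n)%N -> (u n <= e%:E)%E.
Proof.
move=> u0 e0; have h : nbhs (0%E : \bar R) [set y | (y < e%:E)%E].
  apply: open_nbhs_nbhs; split; first exact: open_ereal_lt_ereal.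
  by rewrite /= lte_fin.
have [N _ HN] := u0 _ h; exists N => n Nn; exact/ltW/HN.
Qed.

Section LnormSquare.
Context (R : realType) (disp : measure_display) (T : measurableType disp).
Variable mu : {measure set T -> \bar R}.

(** Turns the extended-real L^2 norm into the real-valued [nsq]; the finiteness
    of the norm is what yields square integrability. *)
Lemma Lnorm2_sqint (g : T -> R) (e : R) : 0 <= e -> measurable_fun setT g ->
  ('N[mu]_2%:E[(fun x => (g x)%:E)] <= e%:E)%E -> sqint mu g /\ nsq mu g <= e ^+ 2.
Proof.
move=> e0 mg ge.
have E : (\int[mu]_x (g x ^+ 2)%:E =
    'N[mu]_2%:E[(fun x => (g x)%:E)] `^ 2)%E.
  rewrite powR_Lnorm//; apply: eq_integral => x _.
  by rewrite abse_EFin poweR_EFin powR_mulrn// real_normK// num_real.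
have le : (\int[mu]_x (g x ^+ 2)%:E <= (e ^+ 2)%:E)%E.
  rewrite E -powR_mulrn// -poweR_EFin; apply: gt0_ler_poweR => //.
  - by rewrite in_itv/= Lnorm_ge0 leey.
  - by rewrite in_itv/= lee_fin e0 leey.
have i2 : mu.-integrable setT (EFin \o (fun x => g x ^+ 2)).
  apply/integrableP; split.
    by apply/measurable_EFinP; exact: measurable_funX.
  under eq_integral do rewrite gee0_abs ?lee_fin ?sqr_ge0//.
  exact: le_lt_trans le (ltry _).
split => //; rewrite -lee_fin /nsq /Rintegral fineK//.
exact: integrable_fin_num.
Qed.

End LnormSquare.

Section L2Integral.
Context (R : realType) (disp : measure_display) (T : measurableType disp).
Variable P : probability T R.
Variable L : R -> {RV P >-> R}.
Hypothesis hL : two_sided_levy L.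
Hypothesis hL_mean : forall t, ('E_P[L t] = 0)%E.
Hypothesis hL_fourth : forall t, ('E_P[(fun w => L t w ^+ 4)%R] < +oo)%E.
Notation leb := (@lebesgue_measure R).
Notation V := (levy_var L).

(** The L^2 integral in terms of squared norms.  Asking for one step function
    for each tolerance, instead of a sequence, lets approximations of several
    integrals be combined without aligning indices. *)
Definition L2approx (f : R -> R) (I : T -> R) :=
  [/\ sqint leb f, sqint P I & forall dl : R, 0 < dl -> exists c,
    [/\ step_code_ok c, nsq leb (fun x => step_fun c x - f x) <= dl
      & nsq P (fun w => step_integral L c w - I w) <= dl]].

Lemma sqint_step_integral c : step_code_ok c -> sqint P (step_integral L c).
Proof.
by move=> /(step_isometry hL hL_mean hL_fourth)[h _ _]; exact: mom4_sqint.
Qed.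

Lemma is_L2_integral_approx (f : R -> R) (I : {RV P >-> R}) :
  measurable_fun setT f -> is_L2_integral L f I -> L2approx f I.
Proof.
move=> mf [c [ok cf cI]].
have key dl : 0 < dl -> exists n,
   [/\ sqint leb (fun x => step_fun (c n) x - f x),
       nsq leb (fun x => step_fun (c n) x - f x) <= dl,
       sqint P (fun w => step_integral L (c n) w - I w)
     & nsq P (fun w => step_integral L (c n) w - I w) <= dl].
  move=> dl0; pose e := Num.min 1 dl.
  have e0 : 0 < e by rewrite lt_min ltr01.
  have e2 : e ^+ 2 <= dl.
    have e1 : e <= 1 by rewrite ge_min lexx.
    apply: (@le_trans _ _ e); last by rewrite ge_min lexx orbT.
    by rewrite expr2 ger_pMr.
  have [N1 h1] := ereal_cvg0_le cf e0; have [N2 h2] := ereal_cvg0_le cI e0.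
  pose n := maxn N1 N2; have n1 := h1 n (leq_maxl _ _); have n2 := h2 n (leq_maxr _ _).
  have mS : measurable_fun setT (step_integral L (c n)).
    exact: sqint_measurable (sqint_step_integral (ok n)).
  have m1 : measurable_fun setT (fun x => step_fun (c n) x - f x).
    by apply: measurable_funB => //; exact: measurable_step.
  have m2 : measurable_fun setT (fun w => step_integral L (c n) w - I w).
    exact: measurable_funB.
  have [s1 b1] := @Lnorm2_sqint _ _ _ leb _ _ (ltW e0) m1 n1.
  have [s2 b2] := Lnorm2_sqint (ltW e0) m2 n2.
  by exists n; split => //; [exact: le_trans e2|exact: le_trans e2].
have [n [s1 _ s2 _]] := key 1 ltr01.
split.
- have := sqintB (sqint_step (ok n)) s1; congr (sqint _ _).
  by apply/funext => x; rewrite subKr.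
- have := sqintB (sqint_step_integral (ok n)) s2; congr (sqint _ _).
  by apply/funext => x; rewrite subKr.
by move=> dl /key[m [_ h1 _ h2]]; exists (c m).
Qed.

Lemma L2approxB f g I J : L2approx f I -> L2approx g J ->
  L2approx (fun x => f x - g x) (fun w => I w - J w).
Proof.
move=> [sf sI aI] [sg sJ aJ]; split; [exact: sqintB|exact: sqintB|].
move=> dl dl0; have d4 : 0 < dl / 4 by rewrite divr_gt0.
have [c [ok cf cI]] := aI _ d4; have [c' [ok' cg cJ]] := aJ _ d4.
pose c'' := c ++ [seq (- q.1, q.2) | q <- c'].
have ok'' : step_code_ok c'' by rewrite /step_code_ok all_cat all_map; apply/andP.
exists c''; split => //.
- rewrite (@nsq_eq _ _ _ leb _ (fun x => (step_fun c x - f x) - (step_fun c' x - g x))).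
    apply: le_trans (nsqB_le2 (sqintB (sqint_step ok) sf) (sqintB (sqint_step ok') sg)) _.
    lra.
  move=> x; rewrite /step_fun big_cat big_map/=.
  under [X in _ + X - _]eq_bigr do rewrite mulNr.
  rewrite sumrN; ring.
- rewrite (@nsq_eq _ _ _ _ _
    (fun x => (step_integral L c x - I x) - (step_integral L c' x - J x))).
    apply: le_trans (nsqB_le2 (sqintB (sqint_step_integral ok) sI)
      (sqintB (sqint_step_integral ok') sJ)) _.
    lra.
  move=> x; rewrite /step_integral big_cat big_map/=.
  under [X in _ + X - _]eq_bigr do rewrite mulNr.
  rewrite sumrN; ring.
Qed.

(** Both sides are limits of the corresponding quantities for step
    functions. *)
Lemma L2approx_isometry f I : L2approx f I ->
  \int[P]_w I w = 0 /\ nsq P I = nsq leb f * V.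
Proof.
move=> [sf sI aI]; split.
  apply/eqP; rewrite -sqrf_eq0 eq_le sqr_ge0 andbT.
  apply/ler_addgt0Pl => e e0; rewrite addr0.
  have [c [ok _ cI]] := aI _ e0.
  have sc := sqint_step_integral ok.
  have [_ c0 _] := step_isometry hL hL_mean hL_fourth ok.
  apply: le_trans cI; apply: le_trans (sqr_mean_le (sqintB sc sI)).
  by rewrite RintegralB ?c0 ?sub0r ?sqrrN//; exact: sqint_integrable1.
apply/eqP; rewrite -subr_eq0 -normr_le0.
apply/ler_addgt0Pl => e e0; rewrite addr0.
have V0 : 0 <= V by exact: levy_var_ge0.
pose e1 := e / (2 * (1 + V)).
have e10 : 0 < e1 by rewrite divr_gt0// mulr_gt0//; lra.
have e1V : e1 * (1 + V) = e / 2 by rewrite /e1; field; rewrite gt_eqF//; lra.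
have [d1 d10 h1] := nsq_cont sf e10; have [d2 d20 h2] := nsq_cont sI e10.
have dm : 0 < Num.min d1 d2 by rewrite lt_min d10.
have [c [ok]] := aI _ dm; rewrite !le_min => /andP[cf _] /andP[_ cI].
have {h1}h1 := h1 _ (sqint_step ok) cf.
have {h2}h2 := h2 _ (sqint_step_integral ok) cI.
have [_ _ c2] := step_isometry hL hL_mean hL_fourth ok.
rewrite c2 in h2; move: h1 h2.
set X := nsq leb (step_fun c); rewrite !ler_norml => /andP[a1 a2] /andP[b1 b2].
apply/andP; split; nra.
Qed.

Definition clip (B x : R) : R := Num.max (- B) (Num.min B x).

Lemma clip_bound B x : 0 <= B -> `|clip B x| <= B.
Proof.
move=> B0; rewrite /clip ler_norml le_max lexx/= ge_max ge_min lexx/= andbT.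
by rewrite (le_trans _ B0)// oppr_le0.
Qed.

Lemma clip_id B x : `|x| <= B -> clip B x = x.
Proof.
rewrite ler_norml => /andP[h1 h2]; rewrite /clip.
by rewrite (min_idPr h2) (max_idPr h1).
Qed.

Lemma clip_lip B x y : `|clip B x - clip B y| <= `|x - y|.
Proof.
wlog yx : x y / y <= x.
  by move=> W; have [/W//|/ltW/W] := leP y x; rewrite distrC (distrC y).
have mono : clip B y <= clip B x.
  rewrite /clip ge_max !le_max lexx/=; apply/orP; right.
  by rewrite le_min !ge_min lexx yx !orbT.
rewrite (ger0_norm (_ : 0 <= x - y)) ?subr_ge0// ger0_norm ?subr_ge0//.
rewrite lerBlDr [clip B x]/clip ge_max; apply/andP; split.
  have : - B <= clip B y by rewrite /clip le_max lexx.
  lra.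
have : Num.min B y <= clip B y by rewrite /clip le_max lexx orbT.
have : Num.min B x <= x by rewrite ge_min lexx orbT.
have : Num.min B x <= B by rewrite ge_min lexx.
have [] := leP B y; lra.
Qed.

(** Truncation at B is 1-Lipschitz and fixes f, so the truncated step function is
    at least as close to f; by the isometry its integral is still close to I,
    and it has bounded values, so [m4_grid] applies. *)
Lemma L2approx_bounded : exists2 K : R, 0 <= K & forall f I B, 0 <= B ->
  L2approx f I -> (forall x, `|f x| <= B) -> forall dl, 0 < dl ->
  exists S, [/\ mom4 P S, nsq P (fun w => I w - S w) <= dl
   & m4 P S <= K * (B ^+ 2 * (nsq leb f + dl) + (nsq leb f + dl) ^+ 2)].
Proof.
have [K K0 hK] := m4_grid hL hL_mean hL_fourth.
exists (4 * K); first by rewrite mulr_ge0.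
move=> f I B B0 [sf sI aI] fB dl dl0.
have V0 : 0 <= V by exact: levy_var_ge0.
(* dl = 2 d1 + 2 (4 d1) V bounds the distance of I to the truncated integral. *)
pose d1 := dl / (2 + 8 * V).
have d10 : 0 < d1 by rewrite divr_gt0//; lra.
have d1V : d1 * (2 + 8 * V) = dl by rewrite /d1 divfK// gt_eqF//; lra.
have d1d : d1 <= dl by nra.
have [c0 [ok0 c0f c0I]] := aI _ d10.
have [v [p [N [pN fE iE]]]] := refine_grid ok0.
pose c := grid_code v p N; pose c' := grid_code (clip B \o v) p N.
have ok : step_code_ok c := grid_code_ok v pN.
have ok' : step_code_ok c' := grid_code_ok _ pN.
have clip0 : clip B 0 = 0 by rewrite clip_id// normr0.
have c'E x : step_fun c' x = clip B (step_fun c x).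
  by rewrite /c (grid_fun_comp v x pN clip0).
have cf : nsq leb (fun x => step_fun c x - f x) <= d1.
  by apply: le_trans c0f; rewrite le_eqVlt (@nsq_eq _ _ _ leb _ (fun x => step_fun c0 x - f x)) ?eqxx// => x; rewrite fE.
have cI : nsq P (fun w => step_integral L c w - I w) <= d1.
  by apply: le_trans c0I; rewrite le_eqVlt (@nsq_eq _ _ _ P _ (fun w => step_integral L c0 w - I w)) ?eqxx// => w; rewrite iE.
have c'f : nsq leb (fun x => step_fun c' x - f x) <= d1.
  apply: le_trans cf; apply: nsq_le.
  - exact: sqintB (sqint_step ok') sf.
  - exact: sqintB (sqint_step ok) sf.
  - by move=> x; rewrite c'E -{1}(clip_id (fB x)) clip_lip.
have cc' : nsq leb (fun x => step_fun c x - step_fun c' x) <= 4 * d1.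
  have := nsqB_le (sqint_step ok) sf (sqint_step ok').
  rewrite (@nsqBC _ _ _ leb f); lra.
pose cd := grid_code (fun i => v i - clip B (v i)) p N.
have okd : step_code_ok cd := grid_code_ok _ pN.
have cdf x : step_fun cd x = step_fun c x - step_fun c' x.
  rewrite /step_fun !big_grid -sumrB; apply: eq_bigr => i _ /=; ring.
have cdI w : step_integral L cd w = step_integral L c w - step_integral L c' w.
  rewrite /step_integral !big_grid -sumrB; apply: eq_bigr => i _ /=; ring.
have [_ _ cd2] := step_isometry hL hL_mean hL_fourth okd.
rewrite (nsq_eq _ cdI) (nsq_eq leb cdf) in cd2.
have cd3 : nsq P (fun w => step_integral L c w - step_integral L c' w) <= 4 * d1 * V.
  by rewrite cd2; exact: ler_wpM2r.
exists (step_integral L c'); split.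
- by have [] := step_isometry hL hL_mean hL_fourth ok'.
- have := nsqB_le sI (sqint_step_integral ok) (sqint_step_integral ok').
  rewrite (nsqBC _ I (step_integral L c)) => h; apply: le_trans h _; lra.
- have := hK (clip B \o v) p N B pN (fun i => clip_bound (v i) B0).
  rewrite -/c'; set F' := nsq _ _ => /= h.
  have F'0 : 0 <= F' by exact: nsq_ge0.
  have F'F : F' <= 2 * (nsq leb f + dl).
    rewrite /F' (@nsq_eq _ _ _ leb _ (fun x => (step_fun c' x - f x) + f x)); last first.
      by move=> x; rewrite subrK.
    have := nsqD_le (sqintB (sqint_step ok') sf) sf; lra.
  set G := nsq leb f + dl in F'F *.
  apply: le_trans h _.
  have -> : 4 * K * (B ^+ 2 * G + G ^+ 2) = K * (B ^+ 2 * (4 * G) + (2 * G) ^+ 2).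
    by ring.
  rewrite ler_wpM2l// lerD//.
    rewrite ler_wpM2l ?sqr_ge0//; lra.
  by rewrite lerXn2r// nnegrE; lra.
Qed.

End L2Integral.

(** * Power kernels *)

Section AffineChange.
Variable R : realType.
Notation leb := (@lebesgue_measure R).

(** The right-hand side is a measure in A, so it suffices to compare lengths of
    intervals. *)
Lemma lebesgue_measure_affine (s h : R) (h0 : 0 < h) (A : set R) : measurable A ->
  leb A = ((h^-1)%:E * leb ((fun u : R => ((u - s) / h)%R) @^-1` A))%E.
Proof.
move=> mA.
pose aff (u : measurableTypeR R) : measurableTypeR R := (u - s) / h.
have maff : measurable_fun setT aff.
  by apply: measurable_funM => //; apply: measurable_funB.
have hi : 0 <= h^-1 by rewrite invr_ge0 ltW.
pose m : {measure set (measurableTypeR R) -> \bar R} :=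
  mscale (NngNum hi)
    (measure_function_pushforward__canonical__measure_function_Measure leb maff).
suff : leb A = m A by [].
apply: lebesgue_measure_unique => // _ [[a b]] _ <-.
transitivity ((h^-1)%:E * leb `](a * h + s)%R, (b * h + s)%R]%classic)%E; last first.
  congr (_ * leb _)%E; apply/seteqP; split => u /=;
  by rewrite !in_itv/= /aff ltr_pdivlMr// ler_pdivrMr// ltrBrDr lerBlDr.
rewrite !lebesgue_measure_itv/= !lte_fin ltrD2r ltr_pM2r//.
case: ifP => ab; last by rewrite mule0.
rewrite -!EFinB -EFinM; congr EFin.
by field; rewrite gt_eqF.
Qed.

Lemma integral_affine (s h : R) (f : R -> \bar R) : 0 < h ->
  measurable_fun setT f -> (forall x, 0 <= f x)%E ->
  (\int[leb]_u f ((u - s) / h)%R = h%:E * \int[leb]_u f u)%E.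
Proof.
move=> h0 mf f0.
pose aff (u : measurableTypeR R) : measurableTypeR R := (u - s) / h.
have maff : measurable_fun setT aff.
  by apply: measurable_funM => //; apply: measurable_funB.
have hi : 0 <= h^-1 by rewrite invr_ge0 ltW.
have -> : (\int[leb]_u f u = \int[mscale (NngNum hi)
   (measure_function_pushforward__canonical__measure_function_Measure leb maff)]_u f u)%E.
  apply: eq_measure_integral => A mA _; exact: lebesgue_measure_affine.
rewrite ge0_integral_mscale//= ge0_integral_pushforward//=.
by rewrite muleA -EFinM divff ?gt_eqF// mul1e.
Qed.

(** The case of an infinite integral is covered as well, since both sides are
    then 0. *)
Lemma nsq_affine (s h c : R) (g : R -> R) : 0 < h -> measurable_fun setT g ->
  nsq leb (fun u => c * g ((u - s) / h)) = c ^+ 2 * h * nsq leb g.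
Proof.
move=> h0 mg.
have mg2 : measurable_fun setT (fun u => (((c * g u) ^+ 2)%R)%:E).
  by apply/measurable_EFinP; apply: measurable_funX; exact: measurable_funM.
have e : (\int[leb]_u (((c * g ((u - s) / h)) ^+ 2)%R)%:E =
    h%:E * \int[leb]_u (((c * g u) ^+ 2)%R)%:E)%E.
  by apply: (integral_affine s h0 mg2) => x; rewrite lee_fin sqr_ge0.
rewrite /nsq /Rintegral e.
have e2 : (\int[leb]_u (((c * g u) ^+ 2)%R)%:E = (c ^+ 2)%:E * \int[leb]_u (g u ^+ 2)%:E)%E.
  under eq_integral do rewrite exprMn EFinM.
  rewrite ge0_integralZl//.
  - by apply/measurable_EFinP; exact: measurable_funX.
  - by move=> x _; rewrite lee_fin sqr_ge0.
  - by rewrite lee_fin sqr_ge0.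
rewrite e2 muleA -EFinM [h * _]mulrC.
have : (0 <= \int[leb]_u (g u ^+ 2)%:E)%E.
  by apply: integral_ge0 => u _; rewrite lee_fin sqr_ge0.
case: (\int[leb]_u (g u ^+ 2)%:E)%E => [r|_|]//=.
have : 0 <= c ^+ 2 * h by rewrite mulr_ge0 ?sqr_ge0// ltW.
rewrite le_eqVlt => /predU1P[<-|ch]; first by rewrite mul0e mul0r.
by rewrite gt0_muley ?lte_fin//= mulr0.
Qed.

End AffineChange.

Section Kernels.
Variable R : realType.
Notation leb := (@lebesgue_measure R).

(** What (x)_+^d and |x|^d have in common: homogeneity gives the scaling of the
    variance, the Hölder bound gives bounded kernels, and the lower bound on a
    short interval makes the variance positive. *)
Definition kernel_base (d : R) (psi : R -> R) :=
  [/\ measurable_fun setT psi,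
      forall h x, 0 < h -> psi (h * x) = h `^ d * psi x,
      forall x h, 0 <= h -> `|psi (x + h) - psi x| <= h `^ d
    & exists2 c, 0 < c & forall u, 0 <= u <= 4^-1 -> c <= psi (1 - u) - psi (- u)].

Definition incr_kernel (psi : R -> R) (s t u : R) := psi (t - u) - psi (s - u).

Lemma measurable_incr_kernel psi s t : measurable_fun setT psi ->
  measurable_fun setT (incr_kernel psi s t).
Proof.
move=> mpsi; have m r : measurable_fun setT (fun u : R => psi (r - u)).
  by apply: measurableT_comp => //; exact: measurable_funB.
exact: measurable_funB.
Qed.

(** The map u |-> (u - s) / (t - s) carries the kernel of the increment over
    ]s, t] to that over ]0, 1], up to the factor (t - s)^d. *)
Lemma kernel_scale d psi s t : kernel_base d psi -> s < t ->
  nsq leb (incr_kernel psi s t) =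
  ((t - s) `^ d) ^+ 2 * (t - s) * nsq leb (incr_kernel psi 0 1).
Proof.
move=> [mpsi hom _ _] st; have h0 : 0 < t - s by rewrite subr_gt0.
rewrite -(nsq_affine s _ h0 (measurable_incr_kernel 0 1 mpsi)).
apply: nsq_eq => u; rewrite /incr_kernel mulrBr -!hom//.
have hn : t - s != 0 by rewrite gt_eqF.
congr (psi _ - psi _); first by rewrite mulrBr mulr1 mulrC divfK//; ring.
by rewrite mulrBr mulr0 mulrC divfK//; ring.
Qed.

Lemma kernel_bound d psi s t u : kernel_base d psi -> s <= t ->
  `|incr_kernel psi s t u| <= (t - s) `^ d.
Proof.
move=> [_ _ H _] st; rewrite /incr_kernel (_ : t - u = (s - u) + (t - s)); last by ring.
by apply: H; rewrite subr_ge0.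
Qed.

Lemma kernel_nsq_gt0 d psi : kernel_base d psi -> sqint leb (incr_kernel psi 0 1) ->
  0 < nsq leb (incr_kernel psi 0 1).
Proof.
move=> [_ _ _ [c c0 hc]] sk.
have q0 : (0 : R) <= 4^-1 by rewrite invr_ge0.
(* The kernel is at least c on ]0, 1/4]. *)
pose g (u : R) : R := c * \1_(`]0, 4^-1]%classic : set R) u.
have g2 u : g u ^+ 2 = c ^+ 2 * \1_(`]0, 4^-1]%classic : set R) u.
  by rewrite /g exprMn indicE; case: (_ \in _); rewrite ?expr1n ?expr0n.
have ig : leb.-integrable setT (EFin \o (fun u => c ^+ 2 * \1_(`]0, 4^-1]%classic : set R) u)).
  by apply: integrableZ_fun; exact: integrable_indic_itv.
have ii : leb.-integrable setT (EFin \o (\1_(`]0, 4^-1]%classic : set R) : R -> R)).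
  exact: integrable_indic_itv.
have : \int[leb]_u (c ^+ 2 * \1_(`]0, 4^-1]%classic : set R) u) <= nsq leb (incr_kernel psi 0 1).
  apply: le_Rintegral => //; first by case: sk.
  move=> u _; rewrite indicE mem_setE in_itv/=.
  case: (boolP (0 < u <= _)) => [/andP[u0 u1]|_]; last by rewrite mulr0 sqr_ge0.
  rewrite mulr1 lerXn2r ?nnegrE ?(ltW c0)//.
    by rewrite (le_trans (ltW c0))// /incr_kernel sub0r hc// (ltW u0).
  by rewrite /incr_kernel sub0r hc// (ltW u0).
rewrite RintegralZl// Rintegral_indic_itvoc// subr0; apply: lt_le_trans.
by rewrite mulr_gt0 ?exprn_gt0// invr_gt0.
Qed.

(** For x = a and x = b the ratio x / (a + b) is at most its d-th power, and the
    two ratios add up to 1. *)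
Lemma powR_subadd (d a b : R) : 0 < d <= 1 -> 0 <= a -> 0 <= b ->
  (a + b) `^ d <= a `^ d + b `^ d.
Proof.
move=> /andP[d0 d1] a0 b0.
have [->|an] := eqVneq a 0; first by rewrite add0r lerDr powR_ge0.
have s0 : 0 < a + b by rewrite ltr_pwDl// lt_neqAle eq_sym an.
have key x : 0 <= x -> x <= a + b -> x / (a + b) * (a + b) `^ d <= x `^ d.
  move=> x0 xs; have [->|xn] := eqVneq x 0; first by rewrite !mul0r powR_ge0.
  have xp : 0 < x by rewrite lt_neqAle eq_sym xn.
  rewrite -[X in _ <= X `^ _](divfK (lt0r_neq0 s0)) powRM ?divr_ge0 ?(ltW s0)//.
  by rewrite ler_wpM2r ?powR_ge0// ger1_powR// divr_gt0//= ler_pdivrMr// mul1r.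
have ha : a <= a + b by rewrite lerDl.
have hb : b <= a + b by rewrite lerDr.
have h1 := key a a0 ha; have h2 := key b b0 hb.
rewrite -[leLHS]mul1r -(divff (lt0r_neq0 s0)) mulrDl mulrDl.
by apply: lerD; [apply: h1|apply: h2].
Qed.

Lemma powR_leD (d a b h : R) : 0 < d <= 1 -> 0 <= a -> 0 <= b -> 0 <= h ->
  a <= b + h -> a `^ d <= b `^ d + h `^ d.
Proof.
move=> d01 a0 b0 h0 abh; apply: le_trans (powR_subadd d01 b0 h0).
have /andP[d0 _] := d01.
by apply: ge0_ler_powR; rewrite ?nnegrE ?addr_ge0// ltW.
Qed.

Lemma quarter_gt (d : R) : 0 < d -> 0 < (3 / 4) `^ d - 4^-1 `^ d.
Proof.
move=> d0; rewrite subr_gt0; apply: gt0_ltr_powR => //; rewrite ?nnegrE; lra.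
Qed.

Lemma pos_pow_base (d : R) : 0 < d <= 1 -> kernel_base d (fun x => pos_pow x d).
Proof.
move=> d01; have /andP[d0 d1] := d01.
have dn : d != 0 by rewrite gt_eqF.
have m0 (x : R) : 0 <= Num.max x 0 by rewrite le_max lexx orbT.
split.
- apply: (@measurableT_comp _ _ _ _ _ _ (fun y : R => y `^ d)).
    exact: measurable_powR.
  exact: measurable_maxr.
- move=> h x h0; by rewrite /pos_pow -(powRM _ (ltW h0) (m0 x)) (maxr_pMr _ _ (ltW h0)) mulr0.
- move=> x h h0; rewrite /pos_pow ger0_norm ?subr_ge0; last first.
    apply: ge0_ler_powR; rewrite ?nnegrE ?m0// ?(ltW d0)//.
    by rewrite ge_max !le_max lerDl h0 lexx !orbT.
  rewrite lerBlDl; apply: powR_leD => //.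
  by rewrite ge_max addr_ge0// andbT lerD2r le_max lexx.
- exists ((3 / 4) `^ d); first by apply: powR_gt0; lra.
  move=> u /andP[u0 u1]; rewrite /pos_pow.
  rewrite (_ : Num.max (- u) 0 = 0) ?powR0 ?subr0//; last first.
    by apply/max_idPr; rewrite oppr_le0.
  apply: ge0_ler_powR; rewrite ?nnegrE ?(ltW d0) ?m0 ?divr_ge0//.
  rewrite le_max; apply/orP; left; lra.
Qed.

Lemma abs_pow_base (d : R) : 0 < d <= 1 -> kernel_base d (fun x => `|x| `^ d).
Proof.
move=> d01; have /andP[d0 d1] := d01.
split.
- apply: (@measurableT_comp _ _ _ _ _ _ (fun y : R => y `^ d)).
    exact: measurable_powR.
  exact: normr_measurable.
- by move=> h x h0; rewrite normrM powRM// (ger0_norm (ltW h0)).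
- move=> x h h0; rewrite ler_norml; apply/andP; split.
    rewrite lerNl opprB lerBlDl; apply: powR_leD => //.
    by rewrite -{1}(addrK h x) (le_trans (ler_normB _ _))// (ger0_norm h0).
  rewrite lerBlDl; apply: powR_leD => //.
  by rewrite (le_trans (ler_normD _ _))// (ger0_norm h0).
- exists ((3 / 4) `^ d - 4^-1 `^ d); first exact: quarter_gt.
  move=> u /andP[u0 u1]; rewrite normrN (ger0_norm u0) ger0_norm; last lra.
  by apply: lerB; apply: ge0_ler_powR; rewrite ?nnegrE ?(ltW d0)//; lra.
Qed.

(** With y = 3^(d/2) the claim follows from 3 y^4 + 1 >= 4 y^3, which holds
    because the difference has the factor (y - 1)^2, and from
    y^3 = 27^(d/2) > 16^(d/2) = (2^d)^2. *)
Lemma strict_convexity (d : R) : 0 < d ->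
  0 < 3 * (3 `^ d) ^+ 2 + 1 - 4 * (2 `^ d) ^+ 2.
Proof.
move=> d0; pose y : R := 3 `^ (d / 2).
have y4 : (3 `^ d) ^+ 2 = y ^+ 4.
  have -> : 3 `^ d = y ^+ 2 :> R.
    by rewrite /y -powR_mulrn ?powR_ge0// -powRrM; congr (_ `^ _); field.
  by ring.
have y3 : (2 `^ d) ^+ 2 < y ^+ 3.
  have -> : (2 `^ d) ^+ 2 = 16 `^ (d / 2) :> R.
    rewrite (_ : 16 = 2 `^ 4%:R); last by rewrite powR_mulrn//; ring.
    rewrite -(powR_mulrn 2 (powR_ge0 _ d)) -!powRrM.
    by have -> : d * 2%:R = 4%:R * (d / 2) by lra.
  have -> : y ^+ 3 = 27 `^ (d / 2) :> R.
    rewrite (_ : 27 = 3 `^ 3%:R); last by rewrite powR_mulrn//; ring.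
    rewrite -(powR_mulrn 3 (powR_ge0 _ (d / 2))) -!powRrM.
    by rewrite [d / 2 * _]mulrC.
  by apply: gt0_ltr_powR; rewrite ?nnegrE ?divr_gt0// ltr_nat.
have y0 : 0 <= y by exact: powR_ge0.
have : 0 <= (y - 1) ^+ 2 * (3 * y ^+ 2 + 2 * y + 1).
  rewrite mulr_ge0 ?sqr_ge0// addr_ge0// addr_ge0// mulr_ge0//.
  exact: sqr_ge0.
rewrite y4.
have -> : (y - 1) ^+ 2 * (3 * y ^+ 2 + 2 * y + 1) = 3 * y ^+ 4 + 1 - 4 * y ^+ 3 by ring.
by move: y3; lra.
Qed.

(** The integrand is dominated by a multiple of an exponential density, so that
    the integral is finite, and it is bounded below on ]1, 2].  Finiteness
    matters: the real-valued integral of a function with infinite integral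
    is 0. *)
Lemma Gamma_gt0 (d : R) : 0 < d <= 1 -> 0 < Gamma (d + 1).
Proof.
move=> /andP[d0 d1]; rewrite /Gamma addrK Rintegral_mkcond.
set f := (fun x : R => x `^ d * expR (- x)).
have mf : measurable_fun setT f.
  apply: measurable_funM; first exact: measurable_powR.
  by apply: measurableT_comp => //; exact: measurable_expR.
have itvE x : (x \in (`]0, +oo[%classic : set R)) = (0 < x).
  by rewrite mem_setE in_itv/= andbT.
have iF : leb.-integrable setT (EFin \o (f \_ (`]0, +oo[%classic : set R))).
  have h0 : (0 : R) < 2^-1 by rewrite invr_gt0.
  apply: (@integrable_le _ _ _ leb _ (fun x => 4 * exponential_pdf 2^-1 x)).
  - apply/measurable_restrict => //; exact: measurable_funTS.
  - move=> x; rewrite patchE itvE; case: ifPn => x0; last first.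
      by rewrite normr0 mulr_ge0// exponential_pdf_ge0// ltW.
    rewrite (exponential_pdfE _ (ltW x0)) /f ger0_norm; last first.
      by rewrite mulr_ge0 ?powR_ge0 ?expR_ge0.
    have xd : x `^ d <= 1 + x.
      have [x1|x1] := leP x 1.
        have : x `^ d <= 1 `^ d.
          by apply: ge0_ler_powR; rewrite ?nnegrE ?(ltW d0) ?(ltW x0).
        by rewrite powR1 => h; apply: le_trans h _; rewrite lerDl ltW.
      by rewrite (le_trans (ler1_powR (ltW x1) d1))// lerDr.
    have e2 : 1 + x <= 2 * expR (x / 2) by have := expR_ge1Dx (x / 2); lra.
    apply: (@le_trans _ _ (2 * expR (x / 2) * expR (- x))).
      by rewrite ler_wpM2r ?expR_ge0// (le_trans xd).
    rewrite -mulrA -expRD (_ : x / 2 - x = - 2^-1 * x); last by field.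
    rewrite mulrA; apply: ler_wpM2r; first exact: expR_ge0.
    lra.
  - by apply: integrableZ_fun; exact: integrable_exponential_pdf.
have ii : leb.-integrable setT (EFin \o (\1_(`]1, 2]%classic : set R) : R -> R)).
  exact: integrable_indic_itv.
have : \int[leb]_u (expR (- 2) * \1_(`]1, 2]%classic : set R) u) <=
       \int[leb]_u (f \_ (`]0, +oo[%classic : set R)) u.
  apply: le_Rintegral => //; first exact: integrableZ_fun.
  move=> u _; rewrite patchE itvE indicE mem_setE in_itv/=.
  case: (boolP (1 < u <= _)) => [/andP[u1 u2]|_].
    rewrite (lt_trans ltr01 u1) mulr1 /f -[leLHS]mul1r; apply: ler_pM; rewrite ?expR_ge0 ?ler_expR ?lerN2//.
    rewrite [X in X <= _](_ : 1 = 1 `^ d); last by rewrite powR1.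
    by apply: ge0_ler_powR; rewrite ?nnegrE ?(ltW d0)//; lra.
  rewrite mulr0; case: ifP => // _.
  by rewrite mulr_ge0 ?powR_ge0 ?expR_ge0.
apply: lt_le_trans; rewrite RintegralZl// Rintegral_indic_itvoc//.
by rewrite ler1n.
Qed.

End Kernels.

(** * Covariances under mixing *)

Section Quantizer.
Variable R : realType.

Definition threshold (m j : nat) : R := j.+1%:R / m%:R - m%:R.

(** The value u truncated to [-m, m] and rounded down to a multiple of 1/m.
    Writing it as a sum of indicators makes covariances of quantized variables
    finite sums of covariances of events. *)
Definition quantize (m : nat) (u : R) : R :=
  m%:R^-1 * (\sum_(j < 2 * m ^ 2) ((threshold m j <= u)%R)%:R) + - m%:R.

Lemma sum_ltn_minn (N k : nat) : (\sum_(j < N) (j < k)%N = minn N k)%N.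
Proof.
elim: N => [|N IH]; first by rewrite big_ord0 min0n.
rewrite big_ord_recr/= IH; case: (ltnP N k) => Nk.
  by rewrite (minn_idPl Nk) addn1.
by rewrite (minn_idPr (leqW Nk)) addn0.
Qed.

(** Inside [-m, m] the error is at most 1/m, outside it is |u| - m; the latter is
    compared with an arbitrary point s through |s| - m <= s^2 / m. *)
Lemma quantize_err (m : nat) (u s : R) : (0 < m)%N ->
  `|u - quantize m u| <= m%:R^-1 + s ^+ 2 / m%:R + `|u - s|.
Proof.
move=> m0; have M0 : 0 < m%:R :> R by rewrite ltr0n.
set M : R := m%:R in M0 *; have Mi : 0 < M^-1 by rewrite invr_gt0.
pose y := M * (u + M); pose k := Num.trunc y.
have yE : u = M^-1 * y - M by rewrite /y mulKf ?gt_eqF//; ring.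
have -> : quantize m u = M^-1 * (minn (2 * m ^ 2) k)%:R - M.
  rewrite /quantize -/M; congr (_ * _ + _).
  rewrite -sum_ltn_minn natr_sum; apply: eq_bigr => j _; congr (_%:R).
  rewrite /k truncn_gt_nat /threshold -/M lerBlDr ler_pdivrMr//.
  by rewrite /y [M * _]mulrC.
have tail x : M <= x -> x - M <= s ^+ 2 / M + `|u - s| -> x - M <= M^-1 + s ^+ 2 / M + `|u - s|.
  by move=> _ h; apply: le_trans h _; rewrite -addrA lerDr ltW.
have sM : `|s| - M <= s ^+ 2 / M.
  rewrite ler_pdivlMr// -[s ^+ 2]real_normK ?num_real//.
  have := sqr_ge0 (`|s| - M); have := sqr_ge0 M; have := sqr_ge0 `|s|.
  rewrite !expr2; nra.
have us : `|u| <= `|s| + `|u - s|.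
  by rewrite -{1}(subrK s u) addrC ler_normD.
have uM : `|u| - M <= s ^+ 2 / M + `|u - s| by lra.
have [y0|y0] := ltP y 0.
  have k0 : k = 0%N.
    by apply/eqP; rewrite -leqn0 leqNgt truncn_gt0 -ltNge (lt_trans y0).
  have uM0 : u + M < 0 by rewrite -(pmulr_rlt0 _ M0).
  rewrite k0 minn0 mulr0 sub0r opprK ltr0_norm//.
  have u0 : u < 0 by lra.
  have := tail (- u); rewrite ltr0_norm// in uM; rewrite opprD; apply => //; lra.
have [yN|yN] := leP ((2 * m ^ 2)%:R) y.
  have kN : (2 * m ^ 2 <= k)%N by rewrite truncn_ge_nat.
  rewrite (minn_idPl kN).
  have NE : (2 * m ^ 2)%:R = 2 * M ^+ 2 by rewrite natrM natrX.
  have -> : M^-1 * (2 * m ^ 2)%:R - M = M by rewrite NE; field; rewrite gt_eqF.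
  have Mu : M <= u.
    rewrite NE in yN.
    have : M * (2 * M) <= M * (u + M) by rewrite /y in yN; nra.
    by rewrite ler_pM2l//; lra.
  rewrite ger0_norm ?subr_ge0//; apply: tail => //.
  by rewrite ger0_norm in uM => //; lra.
have kN : (k <= 2 * m ^ 2)%N.
  have : k%:R <= y by have /andP[] := truncn_itv y0.
  by move=> h; rewrite -(ler_nat R) (le_trans h)// ltW.
rewrite (minn_idPr kN).
have /andP[k1 k2] : k%:R <= y < k.+1%:R by exact: truncn_itv.
rewrite -natr1 in k2.
have -> : u - (M^-1 * k%:R - M) = M^-1 * (y - k%:R) by rewrite {1}yE; ring.
rewrite ger0_norm; last by rewrite mulr_ge0 ?subr_ge0// ltW.
have : M^-1 * (y - k%:R) <= M^-1 by rewrite ger_pMr//; lra.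
have : 0 <= s ^+ 2 / M by rewrite divr_ge0 ?sqr_ge0// ltW.
have := normr_ge0 (u - s); lra.
Qed.

End Quantizer.

Section MixingCovariance.
Context (R : realType) (disp : measure_display) (T : measurableType disp).
Variable P : probability T R.

(** The condition under which a strong mixing coefficient enters the estimates:
    a bounds the dependence of the events described by U and by V. *)
Definition dep_le (a : R) (U V : T -> R) := forall A B : set R,
  measurable A -> measurable B ->
  (`|P (U @^-1` A `&` V @^-1` B) - P (U @^-1` A) * P (V @^-1` B)| <= a%:E)%E.

Lemma dep_le_indic a U V (x y : R) :
  measurable_fun setT U -> measurable_fun setT V -> dep_le a U V ->
  let F w : R := ((x <= U w)%R)%:R in let G w : R := ((y <= V w)%R)%:R in
  [/\ P.-integrable setT (EFin \o F), P.-integrable setT (EFin \o G),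
      P.-integrable setT (EFin \o (fun w => F w * G w)) &
   `|\int[P]_w (F w * G w) - (\int[P]_w F w) * (\int[P]_w G w)| <= a].
Proof.
move=> mU mV UV F G.
have pre (W : T -> R) z : measurable_fun setT W -> measurable (W @^-1` `[z, +oo[%classic).
  by move=> mW; rewrite -[X in measurable X]setTI; exact: mW.
have ind (W : T -> R) z : (fun w => ((z <= W w)%R)%:R : R) = \1_(W @^-1` `[z, +oo[%classic).
  apply/funext => w; have e : (z <= W w) = (w \in W @^-1` `[z, +oo[%classic).
    by apply/idP/idP; rewrite inE/= in_itv/= andbT.
  by rewrite indicE e.
have FE : F = \1_(U @^-1` `[x, +oo[%classic) by exact: ind.
have GE : G = \1_(V @^-1` `[y, +oo[%classic) by exact: ind.
have FGE : (fun w => F w * G w) =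
    \1_(U @^-1` `[x, +oo[%classic `&` V @^-1` `[y, +oo[%classic).
  by rewrite FE GE indicI.
have mI := measurableI _ _ (pre _ x mU) (pre _ y mV).
have int A : measurable A -> \int[P]_w \1_A w = fine (P A).
  by move=> mA; rewrite /Rintegral integral_indic// setIT.
split.
- by rewrite FE; apply: integrable_indic; exact: pre.
- by rewrite GE; apply: integrable_indic; exact: pre.
- by rewrite FGE; exact: integrable_indic.
rewrite FGE FE GE !int//; [|exact: pre|exact: pre].
have := UV _ _ (measurable_itv `[x, +oo[) (measurable_itv `[y, +oo[).
rewrite -lee_fin; congr (_ <= _)%E.
rewrite -[X in `|X - _|%E]fineK ?fin_num_measure//.
rewrite -[X in (_ - X * _)%E]fineK ?fin_num_measure//; last exact: pre.
by rewrite -[X in (_ - _ * X)%E]fineK ?fin_num_measure//; exact: pre.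
Qed.

(** Each of the two quantized variables is, up to a constant, 1/m times a sum of
    2 m^2 indicators, and (2 m^2)^2 / m^2 = 4 m^2. *)
Lemma quantize_cov a U V (m : nat) : (0 < m)%N ->
  measurable_fun setT U -> measurable_fun setT V -> dep_le a U V ->
  [/\ sqint P (quantize m \o U), sqint P (quantize m \o V) &
  `|\int[P]_w (quantize m (U w) * quantize m (V w)) -
   (\int[P]_w quantize m (U w)) * (\int[P]_w quantize m (V w))|
  <= 4 * m%:R ^+ 2 * a].
Proof.
move=> m0 mU mV UV; set N := (2 * m ^ 2)%N.
have M0 : 0 < m%:R :> R by rewrite ltr0n.
pose F (j : 'I_N) w : R := ((threshold R m j <= U w)%R)%:R.
pose G (j : 'I_N) w : R := ((threshold R m j <= V w)%R)%:R.
have H j k := dep_le_indic (threshold R m j) (threshold R m k) mU mV UV.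
have iF j : P.-integrable setT (EFin \o F j) by have [] := H j 0%N.
have iG j : P.-integrable setT (EFin \o G j) by have [_ ?] := H 0%N j.
have iFG j k : P.-integrable setT (EFin \o (fun w => F j w * G k w)).
  by have [] := H j k.
pose S w := \sum_(j < N) F j w; pose S' w := \sum_(j < N) G j w.
have iS : P.-integrable setT (EFin \o S) by exact: integrable_sum_fun.
have iS' : P.-integrable setT (EFin \o S') by exact: integrable_sum_fun.
have SS' w : S w * S' w = \sum_(j < N) \sum_(k < N) F j w * G k w.
  rewrite /S big_distrl/=; apply: eq_bigr => j _; by rewrite big_distrr.
have iSS' : P.-integrable setT (EFin \o (fun w => S w * S' w)).
  rewrite (_ : (fun w => _) = fun w => \sum_(j < N) \sum_(k < N) F j w * G k w).
    by apply: integrable_sum_fun => j; exact: integrable_sum_fun.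
  by apply/funext.
have covS : `|\int[P]_w (S w * S' w) - (\int[P]_w S w) * (\int[P]_w S' w)|
    <= (N%:R * N%:R) * a.
  rewrite (_ : (fun w => S w * S' w) = fun w => \sum_(j < N) \sum_(k < N) F j w * G k w); last first.
    by apply/funext.
  rewrite Rintegral_sum; last by move=> j; exact: integrable_sum_fun.
  rewrite /S /S' !Rintegral_sum// big_distrl/= -sumrB.
  apply: (@le_trans _ _ (\sum_(j < N) \sum_(k < N) a)); last first.
    by rewrite !sumr_const !card_ord -[leLHS]mulr_natl -[X in _ * X <= _]mulr_natl mulrA.
  apply: le_trans (ler_norm_sum _ _ _) _; apply: ler_sum => j _.
  rewrite Rintegral_sum// big_distrr/= -sumrB.
  apply: le_trans (ler_norm_sum _ _ _) _; apply: ler_sum => k _.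
  by have [_ _ _] := H j k.
have mS : measurable_fun setT S by apply/measurable_EFinP; exact: measurable_int iS.
have mS' : measurable_fun setT S' by apply/measurable_EFinP; exact: measurable_int iS'.
have bd (E : 'I_N -> T -> R) : (forall j w, `|E j w| <= 1) ->
    forall w, `|m%:R^-1 * (\sum_(j < N) E j w) + - m%:R| <= m%:R^-1 * N%:R + m%:R.
  move=> E1 w; apply: le_trans (ler_normD _ _) _.
  rewrite normrN (ger0_norm (ltW M0)) lerD2r normrM gtr0_norm ?invr_gt0//.
  rewrite ler_wpM2l ?invr_ge0 ?(ltW M0)//.
  apply: le_trans (ler_norm_sum _ _ _) _.
  apply: (@le_trans _ _ (\sum_(j < N) 1)); first exact: ler_sum.
  by rewrite sumr_const card_ord.
have b1 (b : bool) : `|b%:R : R| <= 1 by case: b; rewrite ?normr1 ?normr0.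
have sq (Z : T -> R) (M : R) : measurable_fun setT Z -> (forall w, `|Z w| <= M) -> sqint P Z.
  move=> mZ ZM; apply: (sqint_le mZ _ (sqint_cst P M)) => w.
  by rewrite (le_trans (ZM w))// ler_norm.
split.
- apply: (sq _ (m%:R^-1 * N%:R + m%:R)).
    by apply: measurable_funD => //; exact: measurable_funM.
  by move=> w; apply: (bd F) => j w'; exact: b1.
- apply: (sq _ (m%:R^-1 * N%:R + m%:R)).
    by apply: measurable_funD => //; exact: measurable_funM.
  by move=> w; apply: (bd G) => j w'; exact: b1.
set b : R := m%:R^-1; set c : R := - m%:R.
have E1 (Z : T -> R) : P.-integrable setT (EFin \o Z) ->
    \int[P]_w (b * Z w + c) = b * (\int[P]_w Z w) + c.
  move=> iZ; rewrite RintegralD//; last 2 first.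
  - exact: integrableZ_fun.
  - exact: finite_measure_integrable_cst.
  by rewrite RintegralZl// Rintegral_cstP.
have E2 : \int[P]_w ((b * S w + c) * (b * S' w + c)) =
    b ^+ 2 * (\int[P]_w (S w * S' w)) +
    (b * c * (\int[P]_w S w) + (b * c * (\int[P]_w S' w) + c ^+ 2)).
  rewrite (_ : (fun w => _) = fun w => b ^+ 2 * (S w * S' w) +
    (b * c * S w + (b * c * S' w + c ^+ 2))); last by apply/funext => w; ring.
  have i1 := integrableZ_fun (b ^+ 2) iSS'.
  have i2 := integrableZ_fun (b * c) iS; have i3 := integrableZ_fun (b * c) iS'.
  have i4 : P.-integrable setT (EFin \o (fun=> c ^+ 2)).
    exact: finite_measure_integrable_cst.
  have i5 := integrableD_fun i3 i4; have i6 := integrableD_fun i2 i5.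
  by rewrite RintegralD// RintegralD// RintegralD// Rintegral_cstP !RintegralZl//.
rewrite /quantize -/b -/c (E1 S iS) (E1 S' iS') E2.
set I2 := Rintegral _ _ _; set I1 := Rintegral _ _ _; set I1' := Rintegral _ _ _.
rewrite (_ : _ - _ = b ^+ 2 * (I2 - I1 * I1')); last by ring.
rewrite normrM ger0_norm ?sqr_ge0//.
apply: le_trans (ler_wpM2l (sqr_ge0 b) covS) _.
rewrite /N natrM natrX /b le_eqVlt; apply/orP; left; apply/eqP.
by field; rewrite gt_eqF.
Qed.

(** Squaring [quantize_err] at s = S, whose last term is small in L^2 and whose
    middle term is controlled by the fourth moment of S. *)
Lemma quantize_nsq_err (U S : T -> R) (m : nat) (dl K : R) : (0 < m)%N ->
  sqint P U -> mom4 P S -> sqint P (quantize m \o U) ->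
  nsq P (fun w => U w - S w) <= dl -> m4 P S <= K ->
  nsq P (fun w => U w - quantize m (U w)) <= 3 * (1 + K) / m%:R ^+ 2 + 3 * dl.
Proof.
move=> m0 sU hS sQ US SK; set M : R := m%:R.
have M0 : 0 < M by rewrite ltr0n.
have sS := mom4_sqint hS; have sUS := sqintB sU sS.
have i1 : P.-integrable setT (EFin \o (fun=> 3 * (M^-1) ^+ 2)).
  exact: finite_measure_integrable_cst.
have i2 : P.-integrable setT (EFin \o (fun w => 3 * (M^-1) ^+ 2 * S w ^+ 4)).
  by apply: integrableZ_fun; case: hS.
have i3 : P.-integrable setT (EFin \o (fun w => 3 * (U w - S w) ^+ 2)).
  by apply: integrableZ_fun; case: sUS.
have i4 := integrableD_fun i2 i3; have i5 := integrableD_fun i1 i4.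
apply: (@le_trans _ _ (\int[P]_w (3 * (M^-1) ^+ 2 +
   (3 * (M^-1) ^+ 2 * S w ^+ 4 + 3 * (U w - S w) ^+ 2)))).
  apply: le_Rintegral => //; first by have [] := sqintB sU sQ.
  move=> w _; have := quantize_err (U w) (S w) m0; rewrite -/M.
  set e := `|U w - _|; rewrite -[X in X <= _ -> _]normr_id.
  rewrite -[(U w - quantize m (U w)) ^+ 2]real_normK ?num_real// -/e.
  rewrite -[(U w - S w) ^+ 2]real_normK ?num_real//.
  set z := `|U w - S w|; set t := S w ^+ 2; rewrite normr_id => h.
  have e0 : 0 <= e by exact: normr_ge0.
  have -> : S w ^+ 4 = t ^+ 2 by rewrite /t; ring.
  apply: (@le_trans _ _ ((M^-1 + t / M + z) ^+ 2)).
    by rewrite lerXn2r ?nnegrE// (le_trans e0).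
  have := sqr_ge0 (M^-1 - t / M); have := sqr_ge0 (M^-1 - z).
  have := sqr_ge0 (t / M - z); nra.
have j2 := hS.2; have j3 := sUS.2.
rewrite RintegralD// RintegralD// Rintegral_cstP !RintegralZl//.
rewrite -/(m4 P S) -/(nsq P (fun w => U w - S w)).
have h : 3 * M^-1 ^+ 2 * m4 P S <= 3 * M^-1 ^+ 2 * K.
  by rewrite ler_wpM2l// mulr_ge0// sqr_ge0.
have -> : 3 * (1 + K) / M ^+ 2 = 3 * M^-1 ^+ 2 + 3 * M^-1 ^+ 2 * K.
  by rewrite exprVn; ring.
lra.
Qed.

(** Write U = h(U) + r and V = h(V) + r' for the quantizer h.  The means of h(U)
    and h(V) are minus those of r and r', so their product is at most Q; the two
    remaining terms of E(U V) contain r or r' and yield to Young's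
    inequality. *)
Lemma mixing_covariance (U V : T -> R) (a : R) (m : nat) (Q Lam th : R) :
  (0 < m)%N -> 0 < th -> dep_le a U V ->
  sqint P U -> sqint P V -> \int[P]_w U w = 0 -> \int[P]_w V w = 0 ->
  nsq P U <= Lam -> nsq P V <= Lam ->
  nsq P (fun w => U w - quantize m (U w)) <= Q ->
  nsq P (fun w => V w - quantize m (V w)) <= Q ->
  \int[P]_w (U w * V w) <=
  4 * m%:R ^+ 2 * a + Q + Q / th + th * (3 / 2 * Lam + Q).
Proof.
move=> m0 th0 UV sU sV U0 V0 UL VL UQ VQ.
have mU := sqint_measurable sU; have mV := sqint_measurable sV.
have [sQ sQ' cov] := quantize_cov m0 mU mV UV.
pose qU w := quantize m (U w); pose qV w := quantize m (V w).
have {}sQ : sqint P qU by []. have {}sQ' : sqint P qV by [].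
pose r w := U w - qU w; pose r' w := V w - qV w.
have sr : sqint P r by exact: sqintB. have sr' : sqint P r' by exact: sqintB.
have -> : \int[P]_w (U w * V w) = \int[P]_w (qU w * qV w) +
    (\int[P]_w (r w * V w) + \int[P]_w (qU w * r' w)).
  rewrite -RintegralD//; [|exact: sqint_mul|exact: sqint_mul].
  rewrite -RintegralD//; [|exact: sqint_mul|].
    by apply: eq_Rintegral => w _; rewrite /r /r'; ring.
  by apply: integrableD_fun; exact: sqint_mul.
have mean_err (Z q : T -> R) : sqint P Z -> sqint P q -> \int[P]_w Z w = 0 ->
    \int[P]_w q w = - \int[P]_w (Z w - q w).
  move=> /sqint_integrable1 iZ /sqint_integrable1 iq Z0.
  by rewrite RintegralB// Z0 sub0r opprK.
have mq := mean_err _ _ sU sQ U0; have mq' := mean_err _ _ sV sQ' V0.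
have h1 := sqr_mean_le sr; have h2 := sqr_mean_le sr'.
have y1 := young_int th0 sr sV; have y2 := young_int th0 sr' sQ.
have q2 : nsq P qU <= 2 * Lam + 2 * Q.
  rewrite (@nsq_eq _ _ _ P qU (fun w => U w - r w)); last first.
    by move=> w; rewrite /r subKr.
  have := nsqB_le2 sU sr; move: UQ; rewrite -/(nsq P r); lra.
move: cov; rewrite -/(\int[P]_w qU w) -/(\int[P]_w qV w) mq mq' mulrNN.
rewrite [\int[P]_w (qU w * r' w)](_ : _ = \int[P]_w (r' w * qU w)); last first.
  by apply: eq_Rintegral => w _; rewrite mulrC.
move: UQ VQ h1 h2 y1 y2; rewrite -/(nsq P r) -/(nsq P r').
set A := \int[P]_w (quantize m (U w) * _); rewrite -/A.
set e1 := \int[P]_w r w; set e2 := \int[P]_w r' w.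
rewrite !ler_norml => rQ rQ' h1 h2 /andP[_ y1] /andP[_ y2] /andP[_ cov].
have ti : 0 < (2 * th)^-1 by rewrite invr_gt0 mulr_gt0.
have k1 : nsq P r / (2 * th) <= Q / (2 * th) by rewrite ler_wpM2r// ltW.
have k2 : nsq P r' / (2 * th) <= Q / (2 * th) by rewrite ler_wpM2r// ltW.
have t2 : 0 <= th / 2 by rewrite divr_ge0// ltW.
have k3 : th / 2 * nsq P V <= th / 2 * Lam by rewrite ler_wpM2l.
have k4 : th / 2 * nsq P qU <= th / 2 * (2 * Lam + 2 * Q) by rewrite ler_wpM2l.
have k5 : e1 * e2 <= Q by have := sqr_ge0 (e1 - e2); rewrite sqrrB; lra.
have k6 : Q / th = Q / (2 * th) + Q / (2 * th) by field; rewrite gt_eqF.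
rewrite k6; lra.
Qed.

End MixingCovariance.

Section SigmaOf.
Context (R : realType) (disp : measure_display) (T : measurableType disp).
Variable P : probability T R.
Variable X : int -> T -> R.

(** The sum is measurable for the sigma-algebra generated by the variables that
    occur in it. *)
Lemma sigma_of_sum (K : set int) (n : nat) (k : nat -> int) (c : R) (B : set R) :
  (forall j, (j < n)%N -> K (k j)) -> measurable B ->
  sigma_of X K ((fun w => c * \sum_(j < n) X (k j) w) @^-1` B).
Proof.
move=> kK mB.
pose G := \bigcup_(i in K) preimage_set_system setT (X i) measurable.
pose T' := g_sigma_algebraType G.
have mZ : measurable_fun setT ((fun w => c * \sum_(j < n) X (k j) w) : T' -> R).
  apply: measurable_funM => //; apply: measurable_sum => j.
  move=> _ C mC; apply: sub_sigma_algebra; exists (k j); first exact: kK.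
  by exists C.
by have := mZ measurableT B mB; rewrite setTI.
Qed.

Lemma mixing_dep_le (n : nat) (a : R) (U V : T -> R) :
  (alpha_mixing P X n <= a%:E)%E ->
  (forall B, measurable B -> sigma_of X [set k | k <= 0] (U @^-1` B)) ->
  (forall B, measurable B -> sigma_of X [set k | n%:Z <= k] (V @^-1` B)) ->
  dep_le P a U V.
Proof.
move=> an hU hV A B mA mB; apply: le_trans an.
apply: ereal_sup_ubound; exists (U @^-1` A); first exact: hU.
by exists (V @^-1` B) => //; exact: hV.
Qed.

End SigmaOf.

(** * Fractional noises *)

Section FractionalNoise.
Context (R : realType) (disp : measure_display) (T : measurableType disp).
Variable P : probability T R.
Variable L : R -> {RV P >-> R}.
Hypothesis hL : two_sided_levy L.
Hypothesis hL_mean : forall t, ('E_P[L t] = 0)%E.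
Hypothesis hL_fourth : forall t, ('E_P[(fun w => L t w ^+ 4)%R] < +oo)%E.
Notation leb := (@lebesgue_measure R).
Notation V := (levy_var L).
Variables (d : R) (psi : R -> R) (J : R -> T -> R).
Hypothesis d0 : 0 < d.
Hypothesis hpsi : kernel_base d psi.
Hypothesis hJ : forall t, L2approx L (incr_kernel psi 0 t) (J t).

Definition frac_incr (s t : R) (w : T) : R := J t w - J s w.
Notation C := (nsq leb (incr_kernel psi 0 1)).

(** The terms psi(- u) in the kernels of J t and J s cancel. *)
Lemma frac_incr_approx s t : L2approx L (incr_kernel psi s t) (frac_incr s t).
Proof.
have := L2approxB hL hL_mean hL_fourth (hJ t) (hJ s); congr (L2approx _ _ _).
by apply/funext => u; rewrite /incr_kernel; ring.
Qed.

Lemma frac_incr_nsq s t : s < t ->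
  nsq P (frac_incr s t) = ((t - s) `^ d) ^+ 2 * (t - s) * (C * V).
Proof.
move=> st; have [_ ->] := L2approx_isometry hL hL_mean hL_fourth (frac_incr_approx s t).
by rewrite (kernel_scale hpsi st) mulrA.
Qed.

Lemma frac_incr_mean s t : \int[P]_w frac_incr s t w = 0.
Proof. by have [] := L2approx_isometry hL hL_mean hL_fourth (frac_incr_approx s t). Qed.

Lemma sqint_frac_incr s t : sqint P (frac_incr s t).
Proof. by have [] := frac_incr_approx s t. Qed.

(** Polarization: the product of two increments is a combination of
    squares of increments. *)
Lemma frac_incr_cov (p q r s : R) :
  2 * \int[P]_w (frac_incr p q w * frac_incr r s w) =
  nsq P (frac_incr p s) - nsq P (frac_incr q s) - nsq P (frac_incr p r) + nsq P (frac_incr q r).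
Proof.
have sq := sqint_frac_incr.
have e1 : nsq P (frac_incr p s) = nsq P (fun w => frac_incr p q w + frac_incr q s w).
  by apply: nsq_eq => w; rewrite /frac_incr; ring.
have e2 : nsq P (frac_incr p r) = nsq P (fun w => frac_incr p q w + frac_incr q r w).
  by apply: nsq_eq => w; rewrite /frac_incr; ring.
have e3 : \int[P]_w (frac_incr p q w * frac_incr q s w) =
   \int[P]_w (frac_incr p q w * frac_incr q r w) + \int[P]_w (frac_incr p q w * frac_incr r s w).
  rewrite -RintegralD//; [|exact: sqint_mul|exact: sqint_mul].
  by apply: eq_Rintegral => w _; rewrite /frac_incr; ring.
rewrite e1 e2 (nsqD (sq p q) (sq q s)) (nsqD (sq p q) (sq q r)) e3; ring.
Qed.

(** The correlation of the increments over ]-x, 0] and ]x, 2x]. *)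
Definition gap_corr : R := (3 * (3 `^ d) ^+ 2 + 1 - 4 * (2 `^ d) ^+ 2) / 2.

Lemma gap_corr_gt0 : 0 < gap_corr.
Proof. by rewrite divr_gt0// strict_convexity. Qed.

Lemma frac_incr_cov_gap x : 0 < x ->
  \int[P]_w (frac_incr (- x) 0 w * frac_incr x (2 * x) w) =
  gap_corr * ((x `^ d) ^+ 2 * x * (C * V)).
Proof.
move=> x0; have := frac_incr_cov (- x) 0 x (2 * x).
rewrite !frac_incr_nsq; try lra.
have -> : 2 * x - - x = 3 * x by ring.
have -> : x - - x = 2 * x by ring.
rewrite !subr0 !powRM ?(ltW x0)// /gap_corr => h.
have two : (2 : R) != 0 by [].
apply: (mulfI two); by rewrite h; field.
Qed.

Definition noise_scale_sqr (x : R) : R := (x `^ d) ^+ 2 * x.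
(** The order x^(d+1/2) of the standard deviation of an increment over an
    interval of length x. *)
Definition noise_scale (x : R) : R := Num.sqrt (noise_scale_sqr x).

Lemma noise_scale_gt0 x : 0 < x -> 0 < noise_scale x.
Proof. by move=> x0; rewrite sqrtr_gt0 mulr_gt0// exprn_gt0// powR_gt0. Qed.

Lemma noise_scaleK x : 0 < x -> noise_scale x ^+ 2 = noise_scale_sqr x.
Proof. by move=> x0; rewrite sqr_sqrtr// mulr_ge0 ?sqr_ge0// ltW. Qed.

(** For x >= 1 the squared kernel bound x^(2d) does not exceed x^(2d+1), so after
    division by the fourth power of the scale both terms of the fourth moment
    bound are bounded uniformly in x. *)
Lemma frac_incr_approx_scaled : exists2 K : R, 0 <= K &
  forall x s t dl, 1 <= x -> t - s = x -> 0 < dl -> dl <= 1 ->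
  exists S, [/\ mom4 P S,
    nsq P (fun w => (noise_scale x)^-1 * frac_incr s t w - S w) <= dl & m4 P S <= K].
Proof.
have [K K0 hK] := L2approx_bounded hL hL_mean hL_fourth.
have C0 : 0 <= C by exact: nsq_ge0.
exists (K * ((C + 1) + (C + 1) ^+ 2)).
  by rewrite mulr_ge0// addr_ge0 ?sqr_ge0// addr_ge0.
move=> x s t dl x1 tsx dl0 dl1.
have x0 : 0 < x by rewrite (lt_le_trans ltr01).
have st : s < t by rewrite -subr_gt0 tsx.
have c0 := noise_scale_gt0 x0; have c2 := noise_scaleK x0.
have s20 : 0 < noise_scale_sqr x by rewrite -c2 exprn_gt0.
have kb u : `|incr_kernel psi s t u| <= x `^ d.
  by rewrite -tsx; exact: kernel_bound hpsi (ltW st).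
have e0 : 0 < noise_scale_sqr x * dl by rewrite mulr_gt0.
have [S [hS S2 S4]] := hK _ _ _ (powR_ge0 x d) (frac_incr_approx s t) kb _ e0.
rewrite (kernel_scale hpsi st) tsx -/(noise_scale_sqr x) -mulrDr in S4.
exists (fun w => (noise_scale x)^-1 * S w); split.
- exact: mom4Z.
- rewrite (@nsq_eq _ _ _ P _ (fun w => (noise_scale x)^-1 * (frac_incr s t w - S w))); last first.
    by move=> w; ring.
  rewrite nsqZ; last exact: sqintB (sqint_frac_incr _ _) (mom4_sqint hS).
  rewrite exprVn c2 mulrC ler_pdivrMr// mulrC.
  by [].
- rewrite m4Z// exprVn mulrC ler_pdivrMr ?exprn_gt0//.
  have -> : noise_scale x ^+ 4 = noise_scale_sqr x ^+ 2 by rewrite -c2; ring.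
  apply: le_trans S4 _; rewrite -[leRHS]mulrA ler_wpM2l//.
  set G := C + dl; have G1 : G <= C + 1 by rewrite lerD2l.
  have G0 : 0 <= G by rewrite addr_ge0// ltW.
  have B2 : (x `^ d) ^+ 2 <= noise_scale_sqr x.
    by rewrite /noise_scale_sqr ler_peMr// sqr_ge0.
  have G2 : G ^+ 2 <= (C + 1) ^+ 2 by rewrite lerXn2r// nnegrE// addr_ge0.
  rewrite exprMn mulrDl; apply: lerD; last first.
    by rewrite mulrC ler_wpM2r ?sqr_ge0.
  rewrite mulrA expr2 [(C + 1) * _]mulrC; apply: ler_pM => //.
  - by rewrite mulr_ge0 ?sqr_ge0// ltW.
  - by apply: ler_wpM2r => //; exact: ltW.
Qed.

Section Noise.
Variables (M : R -> {RV P >-> R}) (kappa : R).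
Hypothesis kappa0 : kappa != 0.
Hypothesis hM : forall t w, M t w = kappa * J t w.

Lemma noise_past n w :
  \sum_(j < n) noise M (- j%:Z) w = M 0 w - M (- n%:R) w.
Proof.
elim: n => [|n IH]; first by rewrite big_ord0 oppr0 subrr.
rewrite big_ord_recr/= IH /noise mulrNz -natr1 opprD.
by rewrite -pmulrn addrA subrK.
Qed.

Lemma noise_future m n w :
  \sum_(j < n) noise M (m + j).+1%:Z w = M (m + n)%:R w - M m%:R w.
Proof.
elim: n => [|n IH]; first by rewrite big_ord0 addn0 subrr.
rewrite big_ord_recr/= IH /noise -pmulrn -natr1 addrK addnS -natr1; ring.
Qed.

Hypothesis V0 : 0 < V.

(** The normalized increments over ]-n, 0] and ]n, 2n] have covariance g for
    every n, while mixing makes the estimate of [mixing_covariance] smaller than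
    g once n is large. *)
Lemma noise_not_mixing : ~ strongly_mixing P (noise M).
Proof.
move=> mix.
have Cp : 0 < C by apply: (kernel_nsq_gt0 hpsi); case: (hJ 1).
pose Lam := C * V; have Lam0 : 0 < Lam by exact: mulr_gt0.
pose g := gap_corr * Lam; have g0 : 0 < g by rewrite mulr_gt0// gap_corr_gt0.
have [K K0 hK] := frac_incr_approx_scaled.
(* Each of the four terms of the estimate is made at most g / 5: th serves the
   last one, Q the second and third, and a, which depends on m, the first. *)
pose th := g / 5 / (3 / 2 * Lam + 1).
have th0 : 0 < th by rewrite divr_gt0//; lra.
pose Q := Num.min 1 (Num.min (g / 5) (th * (g / 5))).
have g5 : 0 < g / 5 by rewrite divr_gt0.
have Q0 : 0 < Q by rewrite !lt_min ltr01 g5 mulr_gt0.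
have Q1 : Q <= 1 by rewrite ge_min lexx.
have Qg : Q <= g / 5 by rewrite !ge_min lexx !orbT.
have Qt : Q <= th * (g / 5) by rewrite !ge_min lexx !orbT.
pose dl := Q / 6; have dl0 : 0 < dl by rewrite divr_gt0.
have dl1 : dl <= 1 by rewrite /dl; lra.
(* dl and m contribute Q / 2 each to the quantization error. *)
pose m := (Num.trunc (6 * (1 + K) / Q)).+1.
have m1 : 1 <= m%:R :> R by rewrite ler1n.
have mQ : 3 * (1 + K) / m%:R ^+ 2 <= Q / 2.
  have mb : 6 * (1 + K) / Q < m%:R by exact: truncnS_gt.
  rewrite ltr_pdivrMr// in mb.
  rewrite ler_pdivrMr ?exprn_gt0 ?ltr0n//.
  have : m%:R * Q <= m%:R ^+ 2 * Q.
    by rewrite ler_wpM2r ?(ltW Q0)// expr2 ler_peMl// (le_trans ler01).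
  lra.
pose a := g / 5 / (4 * m%:R ^+ 2).
have m20 : 0 < 4 * m%:R ^+ 2 :> R by rewrite mulr_gt0// exprn_gt0// ltr0n.
have a0 : 0 < a by rewrite divr_gt0// divr_gt0.
have [N hN] := ereal_cvg0_le mix a0.
pose n := N.+1; pose x : R := n%:R.
have x1 : 1 <= x by rewrite ler1n.
have x0 : 0 < x by rewrite (lt_le_trans ltr01).
have c0 := noise_scale_gt0 x0; have c2 := noise_scaleK x0.
pose U w := (noise_scale x)^-1 * frac_incr (- x) 0 w.
pose W w := (noise_scale x)^-1 * frac_incr x (2 * x) w.
have UE : U = (fun w => (noise_scale x)^-1 / kappa * \sum_(j < n) noise M (- j%:Z) w).
  by apply/funext => w; rewrite noise_past !hM /U /frac_incr -/x; field; rewrite kappa0 gt_eqF.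
have WE : W = (fun w => (noise_scale x)^-1 / kappa * \sum_(j < n) noise M (n + j).+1%:Z w).
  have xx : (n + n)%:R = 2 * x by rewrite natrD -/x; ring.
  apply/funext => w; rewrite noise_future !hM xx -/x /W /frac_incr.
  by field; rewrite kappa0 gt_eqF.
have UW : dep_le P a U W.
  apply: (@mixing_dep_le _ _ _ P (noise M) n); first exact/hN/leqnSn.
    move=> B mB; rewrite UE.
    apply: (@sigma_of_sum _ _ _ (noise M) _ n (fun j => - j%:Z)) => // j _ /=.
    by rewrite oppr_le0.
  move=> B mB; rewrite WE.
  apply: (@sigma_of_sum _ _ _ (noise M) _ n (fun j => (n + j).+1%:Z)) => // j _ /=.
  by rewrite lez_nat -addnS leq_addr.
have sU : sqint P U by apply: sqintZ; exact: sqint_frac_incr.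
have sW : sqint P W by apply: sqintZ; exact: sqint_frac_incr.
have mean0 s t : \int[P]_w ((noise_scale x)^-1 * frac_incr s t w) = 0.
  rewrite RintegralZl ?frac_incr_mean ?mulr0//.
  exact/sqint_integrable1/sqint_frac_incr.
have nLam s t : t - s = x -> nsq P (fun w => (noise_scale x)^-1 * frac_incr s t w) <= Lam.
  move=> ts; have st : s < t by rewrite -subr_gt0 ts.
  rewrite nsqZ ?frac_incr_nsq//; last exact: sqint_frac_incr.
  by rewrite ts -/(noise_scale_sqr x) -c2 exprVn mulrA mulVf ?mul1r// expf_neq0// gt_eqF.
have err s t : t - s = x ->
    sqint P (quantize m \o (fun w => (noise_scale x)^-1 * frac_incr s t w)) ->
    nsq P (fun w => (noise_scale x)^-1 * frac_incr s t w -
                    quantize m ((noise_scale x)^-1 * frac_incr s t w)) <= Q.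
  move=> ts sQ; have [S [hS S2 S4]] := hK x s t dl x1 ts dl0 dl1.
  have := quantize_nsq_err (isT : (0 < m)%N) (sqintZ _ (sqint_frac_incr s t)) hS sQ S2 S4.
  move=> h; apply: le_trans h _; rewrite /dl; lra.
have x0x : 0 - - x = x by ring.
have x2x : 2 * x - x = x by ring.
have [sQU sQW _] := quantize_cov (isT : (0 < m)%N) (sqint_measurable sU)
  (sqint_measurable sW) UW.
have := mixing_covariance (isT : (0 < m)%N) th0 UW sU sW (mean0 _ _) (mean0 _ _)
  (nLam _ _ x0x) (nLam _ _ x2x) (err _ _ x0x sQU) (err _ _ x2x sQW).
have -> : \int[P]_w (U w * W w) = g.
  rewrite (_ : (fun w => U w * W w) = (fun w =>
     (noise_scale_sqr x)^-1 * (frac_incr (- x) 0 w * frac_incr x (2 * x) w))); last first.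
    by apply/funext => w; rewrite /U /W -c2; field; rewrite gt_eqF.
  rewrite RintegralZl//; last exact: sqint_mul (sqint_frac_incr _ _) (sqint_frac_incr _ _).
  rewrite frac_incr_cov_gap// -/(noise_scale_sqr x) /g /Lam; field.
  by rewrite -c2 expf_neq0// gt_eqF.
have -> : 4 * m%:R ^+ 2 * a = g / 5 by rewrite /a mulrC divfK// gt_eqF.
have h1 : Q / th <= g / 5 by rewrite ler_pdivrMr// mulrC.
have h2 : th * (3 / 2 * Lam + Q) <= g / 5.
  have -> : g / 5 = th * (3 / 2 * Lam + 1).
    by rewrite /th divfK// gt_eqF//; lra.
  by rewrite ler_wpM2l ?(ltW th0)// lerD2l.
lra.
Qed.

End Noise.
End FractionalNoise.

Theorem corollary4p4 (R : realType) (disp : measure_display)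
    (T : measurableType disp) (P : probability T R)
    (L : R -> {RV P >-> R}) (d : R) (M1 M2 : R -> {RV P >-> R})
    (hL : two_sided_levy L)
    (hL_nonzero : ~ (forall t, {ae P, forall w, L t w = 0}))
    (hL_mean : forall t, ('E_P[L t] = 0)%E)
    (hL_fourth : forall t, ('E_P[(fun w => L t w ^+ 4)%R] < +oo)%E)
    (hd : 0 < d < 2^-1)
    (hM1 : fractional_levy1 L d M1)
    (hM2 : fractional_levy2 L d M2) :
  ~ strongly_mixing P (noise M1) /\ ~ strongly_mixing P (noise M2).
Proof.
have /andP[d0 d2] := hd.
have d01 : 0 < d <= 1 by apply/andP; split => //; lra.
have V0 : 0 < levy_var L by exact: levy_var_gt0.
split.
- have G0 := Gamma_gt0 d01.
  have hpsi := pos_pow_base d01.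
  apply: (@noise_not_mixing _ _ _ P L hL hL_mean hL_fourth d _
    (fun t w => Gamma (d + 1) * M1 t w) d0 hpsi _ M1 (Gamma (d + 1))^-1) => //.
  + move=> t; have [I hI MI] := hM1 t.
    have mk := measurable_incr_kernel 0 t (let: And4 m _ _ _ := hpsi in m).
    have kE : kernel1 d t = incr_kernel (fun x => pos_pow x d) 0 t.
      by apply/funext => u; rewrite /incr_kernel sub0r.
    rewrite kE in hI.
    have := is_L2_integral_approx hL hL_mean hL_fourth mk hI.
    congr (L2approx _ _ _); apply/funext => w.
    by rewrite MI mulrA divff ?mul1r// gt_eqF.
  + by rewrite invr_eq0 gt_eqF.
  + by move=> t w; rewrite mulrA mulVf ?mul1r// gt_eqF.
- have hpsi := abs_pow_base d01.
  apply: (@noise_not_mixing _ _ _ P L hL hL_mean hL_fourth d _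
    (fun t w => M2 t w) d0 hpsi _ M2 1) => //.
  + move=> t; have hI := hM2 t.
    have mk := measurable_incr_kernel 0 t (let: And4 m _ _ _ := hpsi in m).
    have kE : kernel2 d t = incr_kernel (fun x => `|x| `^ d) 0 t.
      by apply/funext => u; rewrite /incr_kernel sub0r normrN.
    rewrite kE in hI.
    exact (is_L2_integral_approx hL hL_mean hL_fourth mk hI).
  + by move=> t w; rewrite mul1r.
Qed.
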